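(* Consider the RIS-aided MIMO channel $\mathbf G=\sqrt{\beta_{\mathrm t}\beta_{\mathrm r}}\mathbf R\boldsymbol\Phi\mathbf T+\sqrt{\beta_{\mathrm d}}\mathbf H$ described in the context, with $N_{\mathrm r}\ge N_{\mathrm t}$, and let $C=\mathbb E\{\log_2\det(\mathbf I_{N_{\mathrm r}}+\bar\rho\,\mathbf G\mathbf G^{\dagger})\}$ with $\bar\rho=\rho/N_{\mathrm t}$, $\rho>0$. Then $$C\le\log_2\Big(\sum_{t=0}^{N_{\mathrm t}}\bar\rho^{\,t}\sum_{\mathcal Q\subseteq\{1,\dots,N_{\mathrm t}\},\,|\mathcal Q|=t}\det(\boldsymbol\Psi_{\mathcal Q})\,\mathsf J_{N_{\mathrm r}}\big(\tilde\theta_1,\dots,\tilde\theta_{L_{\mathcal Q}}\big)\frac{(N_{\mathrm r}-L_{\mathcal Q})!}{(N_{\mathrm r}-t)!}\Big),$$ where for each $\mathcal Q$, $\tilde\theta_1,\dots,\tilde\theta_{L_{\mathcal Q}}$ are the non-zero eigenvalues of $\boldsymbol\Psi_{\mathcal Q}^{-1}\boldsymbol\Sigma_{\mathcal Q}$ with $\boldsymbol\Sigma=\bar{\mathbf G}^{\dagger}\bar{\mathbf G}$.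
   Context: Setup: $N_{\mathrm t},N_{\mathrm r},M=M_{\mathrm h}M_{\mathrm v}$ positive integers; $\mathbf T\in\mathbb C^{M\times N_{\mathrm t}}$, $\bar{\mathbf R}\in\mathbb C^{N_{\mathrm r}\times M}$, $\bar{\mathbf H}\in\mathbb C^{N_{\mathrm r}\times N_{\mathrm t}}$ are line-of-sight matrices of the form $\mathbf T=\sum_{i=1}^{P_{\mathbf T}}\frac{t_i}{\sqrt{P_{\mathbf T}}}\mathbf a_{M_{\mathrm h},M_{\mathrm v}}(\varphi_{a_1,i},\theta_{a_1,i})\mathbf a_{N_{\mathrm t}}(\theta_{d_1,i})^\intercal$, $\bar{\mathbf R}=\sum_{i=1}^{P_{\mathbf R}}\frac{r_i}{\sqrt{P_{\mathbf R}}}\mathbf a_{N_{\mathrm r}}(\theta_{a_2,i})\mathbf a_{M_{\mathrm h},M_{\mathrm v}}(\varphi_{d_2,i},\theta_{d_2,i})^\intercal$, $\bar{\mathbf H}=\sum_{i=1}^{P_{\mathbf H}}\frac{h_i}{\sqrt{P_{\mathbf H}}}\mathbf a_{N_{\mathrm r}}(\theta_{a_3,i})\mathbf a_{N_{\mathrm t}}(\theta_{d_3,i})^\intercal$, where $\mathbf a_N(\theta)=[e^{\mathsf j2\pi(n-1)\frac{d}{\lambda}\sin\theta}]_{n=1}^{N}$ (column; $d=d_{\mathrm t}$ for $N_{\mathrm t}$, $d=d_{\mathrm r}$ for $N_{\mathrm r}$) and $\mathbf a_{M_{\mathrm h},M_{\mathrm v}}(\varphi,\theta)^\intercal=[e^{\mathsf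 j2\pi(m-1)\frac{d_{\mathrm v}}{\lambda}\sin\theta}]_{m=1}^{M_{\mathrm v}}\otimes[e^{\mathsf j2\pi(n-1)\frac{d_{\mathrm h}}{\lambda}\cos\theta\sin\varphi}]_{n=1}^{M_{\mathrm h}}$. The gains $t_i,r_i,h_i$ (i.i.d. $\mathcal{CN}(0,1)$ in the model) and all angles are treated as fixed (the result is conditional on them). $\boldsymbol\Phi=\mathrm{diag}\{e^{\mathsf j\theta_1},\dots,e^{\mathsf j\theta_M}\}$ is fixed. $\beta_{\mathrm t},\beta_{\mathrm r},\beta_{\mathrm d}>0$; $L_{\mathbf R}+N_{\mathbf R}=1$, $L_{\mathbf H}+N_{\mathbf H}=1$, all $\ge0$, and $N_{\mathbf H}>0$. $\mathbf R=\sqrt{L_{\mathbf R}}\bar{\mathbf R}+\sqrt{N_{\mathbf R}}\tilde{\mathbf R}$, $\mathbf H=\sqrt{L_{\mathbf H}}\bar{\mathbf H}+\sqrt{N_{\mathbf H}}\tilde{\mathbf H}$ with $\tilde{\mathbf R},\tilde{\mathbf H}$ independent with i.i.d. $\mathcal{CN}(0,1)$ entries; the expectation is over $\tilde{\mathbf R},\tilde{\mathbf H}$. Define $\bar{\mathbf G}=\sqrt{\beta_{\mathrm t}\beta_{\mathrm r}L_{\mathbf R}}\bar{\mathbf R}\boldsymbol\Phi\mathbf T+\sqrt{\beta_{\mathrm d}L_{\mathbf H}}\bar{\mathbf H}$ and $\boldsymbol\Psi=\beta_{\mathrm t}\beta_{\mathrm r}N_{\mathbf R}\mathbf T^{\dagger}\mathbf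 T+\beta_{\mathrm d}N_{\mathbf H}\mathbf I_{N_{\mathrm t}}$. For a square matrix $\mathbf A$ and index set $\mathcal Q$, $\mathbf A_{\mathcal Q}$ is the principal submatrix with rows and columns indexed by $\mathcal Q$ (for $\mathcal Q=\emptyset$ its determinant is $1$). For an integer $q$ and numbers $\theta_1,\dots,\theta_L$: $\mathsf J_q(\theta_1,\dots,\theta_L)=\det(\boldsymbol\Delta)/V(\theta_1,\dots,\theta_L)$, where $\boldsymbol\Delta\in\mathbb C^{L\times L}$ has $(i,j)$ entry $(q-L+j+\theta_i)\theta_i^{j-1}$ and $V(\theta_1,\dots,\theta_L)=\prod_{i<j\le L}(\theta_j-\theta_i)$; $\mathsf J_q=1$ when $L=0$, and when eigenvalues coincide the ratio is understood as its limit. *)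

(* Defs.v *)
From HB Require Import structures.
From mathcomp Require Import all_boot all_order all_algebra.
From mathcomp Require Import all_classical all_reals all_analysis.
From mathcomp Require Import complex.

Set Implicit Arguments.
Unset Strict Implicit.
Unset Printing Implicit Defensive.

Import Order.TTheory GRing.Theory Num.Theory.
Import numFieldNormedType.Exports.

Local Open Scope classical_set_scope.
Local Open Scope ring_scope.
Local Open Scope complex_scope.

Section RISDefs.
Variable R : realType.
Local Notation C := R[i].

Definition cexpi (x : R) : C := (cos x) +i* (sin x).

Definition csqrt (x : R) : C := (Num.sqrt x)%:C.

Definition ctr m n (A : 'M[C]_(m, n)) : 'M[C]_(n, m) := (map_mx conjc A)^T.

(** ULA steering vector a_N(theta) (column), dl = d / lambda *)
Definition ula (N : nat) (dl th : R) : 'cV[C]_N :=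
  \col_(n < N) cexpi (2 * pi * n%:R * dl * sin th).

(** UPA steering vector a_{Mh,Mv}(phi,theta)^T (a row vector):
    [e^{j2pi (m-1) dv/lambda sin th}]_{m<=Mv} (x) [e^{j2pi (n-1) dh/lambda cos th sin phi}]_{n<=Mh},
    Kronecker index k = m * Mh + n (0-based). *)
Definition upaT (Mh Mv : nat) (dhl dvl ph th : R) : 'rV[C]_(Mh * Mv) :=
  \row_(k < Mh * Mv)
     (cexpi (2 * pi * (k %/ Mh)%:R * dvl * sin th)
      * cexpi (2 * pi * (k %% Mh)%:R * dhl * cos th * sin ph)).

Definition Tlos (Nt Mh Mv PT : nat) (dtl dhl dvl : R) (tg : 'I_PT -> C)
  (phia1 tha1 thd1 : 'I_PT -> R) : 'M[C]_(Mh * Mv, Nt) :=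
  \sum_(i < PT) ((tg i / csqrt PT%:R) *:
      ((upaT Mh Mv dhl dvl (phia1 i) (tha1 i))^T *m (ula Nt dtl (thd1 i))^T)).

Definition Rlos (Nr Mh Mv PR : nat) (drl dhl dvl : R) (rg : 'I_PR -> C)
  (tha2 phid2 thd2 : 'I_PR -> R) : 'M[C]_(Nr, Mh * Mv) :=
  \sum_(i < PR) ((rg i / csqrt PR%:R) *:
      (ula Nr drl (tha2 i) *m upaT Mh Mv dhl dvl (phid2 i) (thd2 i))).

Definition Hlos (Nr Nt PH : nat) (drl dtl : R) (hg : 'I_PH -> C)
  (tha3 thd3 : 'I_PH -> R) : 'M[C]_(Nr, Nt) :=
  \sum_(i < PH) ((hg i / csqrt PH%:R) *:
      (ula Nr drl (tha3 i) *m (ula Nt dtl (thd3 i))^T)).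

Definition Phimat M (thphi : 'I_M -> R) : 'M[C]_M := diag_mx (\row_(m < M) cexpi (thphi m)).

Definition Gchan Nr Nt M (bt br bd LR NR LH NH : R)
  (Rb : 'M[C]_(Nr, M)) (Ph : 'M[C]_M) (T : 'M[C]_(M, Nt)) (Hb : 'M[C]_(Nr, Nt))
  (Rt : 'M[C]_(Nr, M)) (Ht : 'M[C]_(Nr, Nt)) : 'M[C]_(Nr, Nt) :=
  csqrt (bt * br) *: ((csqrt LR *: Rb + csqrt NR *: Rt) *m Ph *m T)
  + csqrt bd *: (csqrt LH *: Hb + csqrt NH *: Ht).

Definition Gbar Nr Nt M (bt br bd LR LH : R)
  (Rb : 'M[C]_(Nr, M)) (Ph : 'M[C]_M) (T : 'M[C]_(M, Nt)) (Hb : 'M[C]_(Nr, Nt)) :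
  'M[C]_(Nr, Nt) :=
  csqrt (bt * br * LR) *: (Rb *m Ph *m T) + csqrt (bd * LH) *: Hb.

Definition Psimat Nt M (bt br bd NR NH : R) (T : 'M[C]_(M, Nt)) : 'M[C]_Nt :=
  (bt * br * NR)%:C *: (ctr T *m T) + (bd * NH)%:C%:M.

Definition psub n (Q : {set 'I_n}) (A : 'M[C]_n) : 'M[C]_#|Q| :=
  \matrix_(i < #|Q|, j < #|Q|) A (enum_val i) (enum_val j).

(** the function J_q(theta_1..theta_L) = det(Delta)/V, understood as its limit
    (along points with pairwise distinct coordinates) when eigenvalues coincide *)
Definition Delta (q L : nat) (x : 'rV[R]_L) : 'M[R]_L :=
  \matrix_(i < L, j < L) (((q%:R - L%:R + (j.+1)%:R + x 0 i) * x 0 i ^+ j)%R : R).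

Definition Vand (L : nat) (x : 'rV[R]_L) : R :=
  \prod_(i < L) \prod_(j < L | (i < j)%N) (x 0 j - x 0 i).

Definition Jratio (q L : nat) (x : 'rV[R]_L) : R := \det (Delta q x) / Vand x.

Definition Jfun (q : nat) (s : seq R) : R :=
  lim (Jratio q (L := size s) @
         within [set x : 'rV[R]_(size s) | Vand x != 0]
           (nbhs (\row_(i < size s) s`_i))).

Definition log2 (x : R) : R := ln x / ln 2.

Definition mutually_independent d (Omega : measurableType d)
  (P : probability Omega R) (I : finType) (X : I -> Omega -> R) : Prop :=
  forall (J : {set I}) (A : I -> set R), (forall i, measurable (A i)) ->
    P (\bigcap_(i in [set` J]) (X i @^-1` A i)) =
    (\prod_(i in J) P (X i @^-1` A i))%E.

Definition part (b : bool) (z : C) : R := if b then complex.Re z else complex.Im z.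

Definition entries_family d (Omega : measurableType d) Nr M Nt
  (Rt : Omega -> 'M[C]_(Nr, M)) (Ht : Omega -> 'M[C]_(Nr, Nt)) :
  ('I_Nr * 'I_M * bool) + ('I_Nr * 'I_Nt * bool) -> Omega -> R :=
  fun i => match i with
           | inl (j, k, b) => fun w => part b (Rt w j k)
           | inr (j, k, b) => fun w => part b (Ht w j k)
           end.

(** Rtilde, Htilde independent with i.i.d. CN(0,1) entries: all real and
    imaginary parts are mutually independent N(0, 1/2) random variables *)
Definition iid_CN01 d (Omega : measurableType d) (P : probability Omega R)
  Nr M Nt (Rt : Omega -> 'M[C]_(Nr, M)) (Ht : Omega -> 'M[C]_(Nr, Nt)) : Prop :=
  let X := entries_family Rt Ht in
  [/\ forall i, measurable_fun setT (X i),
      forall i (A : set R), measurable A ->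
        P (X i @^-1` A) = normal_prob 0 (Num.sqrt (2^-1)) A
    & mutually_independent P X].

Definition nonzero_eigs n (A : 'M[C]_n) (s : seq R) : Prop :=
  all (fun a => a != 0) s /\
  char_poly A = 'X^(n - size s) * \prod_(a <- s) ('X - (a%:C)%:P).

Definition ris_bound (Nt Nr : nat) (rhob : R) (Psi Sigma : 'M[C]_Nt)
  (theta : {set 'I_Nt} -> seq R) : C :=
  \sum_(t < Nt.+1) (rhob%:C ^+ t *
     \sum_(Q : {set 'I_Nt} | #|Q| == t)
        (\det (psub Q Psi) * (Jfun Nr (theta Q))%:C
         * (((Nr - size (theta Q))`!)%:R / ((Nr - t)`!)%:R))).

End RISDefs.

(* Main.v *)
Require Import Defs.
From HB Require Import structures.
From mathcomp Require Import all_boot all_order all_algebra.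
From mathcomp Require Import perm ring lra.
From mathcomp Require Import all_classical all_reals all_analysis.
From mathcomp Require Import measurable_realfun complex.

Set Implicit Arguments.
Unset Strict Implicit.
Unset Printing Implicit Defensive.

Import Order.TTheory GRing.Theory Num.Theory.
Import numFieldNormedType.Exports.

Local Open Scope classical_set_scope.
Local Open Scope ring_scope.
Local Open Scope complex_scope.

(** Sylvester's identity and the expansion into principal minors give
    [det (1 + r G G^H) = sum_Q r^|Q| det ((G^H G)_Q)], which is at least [1];
    by concavity of the logarithm it suffices to compute the mean of
    [det (A^H A)] for a matrix [A] with [n] independent rows and [t] columns.
    Now [A^H A] is the sum over the rows of the rank one matrices
    [conj(a_k)^T a_k], so [det (A^H A)] is the sum over the injections
    [f : [t] -> [n]] of the determinants whose [i]-th row is the [i]-th row of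
    the [f i]-th summand.  These rows are independent, so only second moments
    matter, and the mean is obtained by replacing each summand by
    [conj(abar_k)^T abar_k + Psi].  Expanding multilinearly and counting the
    extensions of injections defined on a set [S] of rows gives
    [sum_S (n - |S|)! / (n - t)! det (rows S of Sigma, the others of Psi)],
    that is, [det Psi] times [sum_k e_k(theta) (n - k)! / (n - t)!] where
    [det (Psi + x Sigma) = det Psi prod_i (1 + x theta_i)].  Finally
    [J_q(theta) = sum_k e_k(theta) (q - k)! / (q - L)!], because [Delta] is a
    Vandermonde matrix times a companion-like matrix. *)

(** * Determinants *)

Section DeterminantExpansions.
Variable F : comNzRingType.

(** Each Leibniz product is a product of sums, and distributing it amounts to choosing one summand
    [f i] for every row [i]. *)
Lemma det_sum_rows n (K : finType) (A : K -> 'I_n -> 'I_n -> F) :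
  \det (\matrix_(i, j) \sum_k A k i j) =
  \sum_(f : {ffun 'I_n -> K}) \det (\matrix_(i, j) A (f i) i j).
Proof.
rewrite exchange_big /=; apply: eq_bigr => s _.
under eq_bigr do rewrite mxE.
rewrite bigA_distr_bigA big_distrr /=; apply: eq_bigr => f _; congr (_ * _).
by apply: eq_bigr => i _; rewrite mxE.
Qed.

(** Choosing rows inside a matrix of fixed size keeps all determinants of a multilinear expansion
    comparable, with no submatrices indexed by [S]. *)
Definition mixmx n (S : {set 'I_n}) (A B : 'M[F]_n) : 'M[F]_n :=
  \matrix_(i, j) (if i \in S then A i j else B i j).

Lemma det_addmx n (A B : 'M[F]_n) :
  \det (A + B) = \sum_(S : {set 'I_n}) \det (mixmx S A B).
Proof.
rewrite exchange_big /=; apply: eq_bigr => s _.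
under eq_bigr do rewrite mxE.
rewrite bigA_distr big_distrr /=; apply: eq_big => // S _; congr (_ * _).
by apply: eq_bigr => i _; rewrite mxE.
Qed.

Lemma det_scale_rows n (c : 'I_n -> F) (A : 'M[F]_n) :
  \det (\matrix_(i, j) (c i * A i j)) = (\prod_i c i) * \det A.
Proof.
rewrite -[\prod_i _](_ : \det (diag_mx (\row_i c i)) = _); last first.
  by rewrite det_diag; apply: eq_bigr => i _; rewrite mxE.
by rewrite -det_mulmx mul_diag_mx; congr (\det _); apply/matrixP => i j; rewrite !mxE.
Qed.

(** The same permutation acts on rows and columns, so its sign cancels. The sizes are only
    propositionally equal because the use below has [m = #|S| + #|~: S|]. *)
Lemma det_mxsub_bij m n (h : 'I_m -> 'I_n) (A : 'M[F]_n) :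
  m = n -> injective h -> \det (mxsub h h A) = \det A.
Proof.
move=> emn; case: n / emn in h A * => hI.
pose s := perm hI.
have -> : mxsub h h A = row_perm s (col_perm s A).
  by apply/matrixP => i j; rewrite !mxE !permE.
rewrite row_permE col_permE !det_mulmx !det_perm odd_permV mulrC -mulrA.
by rewrite -signr_addb addbb mulr1.
Qed.

Lemma prod_if_const n (S : {set 'I_n}) (c : F) :
  \prod_(i < n) (if i \in S then c else 1) = c ^+ #|S|.
Proof. by rewrite -big_mkcond /= prodr_const. Qed.

Lemma det_mixmxZ n (S : {set 'I_n}) (a b : F) (A B : 'M[F]_n) :
  \det (mixmx S (a *: A) (b *: B)) =
  a ^+ #|S| * b ^+ (n - #|S|) * \det (mixmx S A B).
Proof.
have -> : a ^+ #|S| * b ^+ (n - #|S|) = \prod_i (if i \in S then a else b).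
  rewrite -(prod_if_const S a) (_ : (n - #|S|)%N = #|~: S|); last first.
    by rewrite -[X in (X - _)%N]card_ord -(cardsC S) addnC addnK.
  rewrite -(prod_if_const (~: S) b) -big_split /=; apply: eq_bigr => i _.
  by rewrite finset.in_setC; case: ifP => _ /=; rewrite ?mulr1 ?mul1r.
rewrite -det_scale_rows; congr (\det _); apply/matrixP => i j; rewrite !mxE.
by case: ifP.
Qed.

Definition principal n (S : {set 'I_n}) (A : 'M[F]_n) : 'M[F]_#|S| :=
  mxsub enum_val enum_val A.

(** Listing [S] before its complement makes the mixed matrix block upper triangular with an identity
    block. *)
Lemma det_principal n (S : {set 'I_n}) (A : 'M[F]_n) :
  \det (principal S A) = \det (mixmx S A 1%:M).
Proof.
pose h (k : 'I_(#|S| + #|~: S|)) : 'I_n :=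
  match fintype.split k with inl i => enum_val i | inr j => enum_val j end.
have hl i : h (lshift _ i) = enum_val i.
  by rewrite /h; case: splitP => [j|j] /= e; [congr enum_val; apply/val_inj
    |have := ltn_ord i; rewrite e ltnNge leq_addr].
have hr i : h (rshift _ i) = enum_val i.
  rewrite /h; case: splitP => [j|j] /= e.
    by have := ltn_ord j; rewrite -e ltnNge leq_addr.
  by congr enum_val; apply/val_inj => /=; move/eqP: e; rewrite eqn_add2l => /eqP ->.
have nin (i : 'I_#|~: S|) : enum_val i \notin S by have := enum_valP i; rewrite finset.in_setC.
have neq (i : 'I_#|S|) (j : 'I_#|~: S|) : (enum_val i == enum_val j) = false.
  by apply/negP => /eqP e; have := nin j; rewrite -e enum_valP.
have hI : injective h.
  move=> k1 k2; rewrite -(splitK k1) -(splitK k2).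
  case: (fintype.split k1) (fintype.split k2) => [i1|i1] [i2|i2] /=; rewrite ?hl ?hr.
  - by move/enum_val_inj ->.
  - by move/eqP; rewrite neq.
  - by move/eqP; rewrite eq_sym neq.
  - by move/enum_val_inj ->.
rewrite -(det_mxsub_bij (mixmx S A 1%:M) _ hI); last by rewrite cardsC card_ord.
have -> : mxsub h h (mixmx S A 1%:M) =
    block_mx (principal S A) (mxsub enum_val enum_val A) 0 1%:M.
  apply/matrixP => k1 k2; rewrite -(splitK k1) -(splitK k2).
  case: (fintype.split k1) (fintype.split k2) => [i1|i1] [i2|i2] /=;
    rewrite ?block_mxEul ?block_mxEur ?block_mxEdl ?block_mxEdr !mxE ?hl ?hr
      ?enum_valP ?(negPf (nin _)) //.
  - by rewrite eq_sym neq.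
  - by rewrite (inj_eq enum_val_inj).
by rewrite det_ublock det1 mulr1.
Qed.

Lemma det_1Dscale n (c : F) (A : 'M[F]_n) :
  \det (1%:M + c *: A) = \sum_(S : {set 'I_n}) c ^+ #|S| * \det (principal S A).
Proof.
rewrite addrC det_addmx; apply: eq_bigr => S _.
by rewrite -[1%:M]scale1r det_mixmxZ expr1n mulr1 det_principal.
Qed.

(** Sylvester's identity: a unipotent factor to the left or to the right of [U] makes it block
    triangular, with one of the two determinants as the remaining block. *)
Lemma det_1D_mulmxC m n (A : 'M[F]_(m, n)) (B : 'M[F]_(n, m)) :
  \det (1%:M + A *m B) = \det (1%:M + B *m A).
Proof.
pose U : 'M[F]_(m + n) := block_mx 1%:M (- A) B 1%:M.
have e1 : block_mx 1%:M A 0 1%:M *m U = block_mx (1%:M + A *m B) 0 B 1%:M.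
  by rewrite mulmx_block !mul1mx !mulmx1 !mul0mx !add0r addNr.
have e2 : U *m block_mx 1%:M A 0 1%:M = block_mx 1%:M 0 B (1%:M + B *m A).
  by rewrite mulmx_block !mulmx1 !mulmx0 mul1mx !addr0 subrr addrC.
have /eqP := congr1 determinant e1; have /eqP := congr1 determinant e2.
rewrite !det_mulmx !det_ublock !det_lblock !det1 !mulr1 !mul1r => /eqP <- /eqP <-.
by [].
Qed.

End DeterminantExpansions.

(** * Row expansions of the determinant of a product *)

Section GramExpansion.
Variable F : comNzRingType.

Lemma det_rank1_rows n t (B : 'M[F]_(t, n)) (A : 'M[F]_(n, t)) (f : 'I_t -> 'I_n) :
  \det (\matrix_(i, j) (B i (f i) * A (f i) j)) =
  (\prod_i B i (f i)) * \det (\matrix_(i, j) A (f i) j).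
Proof.
rewrite -det_scale_rows; congr (\det _).
by apply/matrixP => i j; rewrite !mxE.
Qed.

Lemma det_mulmx_rows n t (B : 'M[F]_(t, n)) (A : 'M[F]_(n, t)) :
  \det (B *m A) = \sum_(f : {ffun 'I_t -> 'I_n})
    (\prod_i B i (f i)) * \det (\matrix_(i, j) A (f i) j).
Proof.
under eq_bigr do rewrite -det_rank1_rows.
rewrite -(det_sum_rows (fun k i j => B i k * A k j)).
by congr (\det _); apply/matrixP => i j; rewrite !mxE.
Qed.

Lemma det_noninj_rows n t (A : 'M[F]_(n, t)) (f : 'I_t -> 'I_n) :
  ~~ injectiveb f -> \det (\matrix_(i < t, j < t) A (f i) j) = 0.
Proof.
move/injectivePn => [x [y xy e]]; apply: (determinant_alternate xy) => j.
by rewrite !mxE e.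
Qed.

(** A repeated row kills the determinant, so only injections survive. Row [i] of each term involves
    row [f i] of [A] only, and these rows are distinct; this is what later makes independence
    applicable. *)
Lemma det_mulmx_inj n t (B : 'M[F]_(t, n)) (A : 'M[F]_(n, t)) :
  \det (B *m A) = \sum_(f : {ffun 'I_t -> 'I_n} | injectiveb f)
    \det (\matrix_(i, j) (B i (f i) * A (f i) j)).
Proof.
rewrite det_mulmx_rows (bigID [pred f : {ffun _} | injectiveb f]) /=.
rewrite [X in _ + X]big1 => [|f fI]; last by rewrite det_noninj_rows ?mulr0.
by rewrite addr0; apply: eq_bigr => f _; rewrite det_rank1_rows.
Qed.

(* Averaging the expansion over all relabelings of the rows turns the product
   of the entries of [B] into a second determinant. *)
Lemma det_mulmx_sym n t (B : 'M[F]_(t, n)) (A : 'M[F]_(n, t)) :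
  (t`!)%:R * \det (B *m A) = \sum_(f : {ffun 'I_t -> 'I_n})
    \det (\matrix_(i, j) B i (f j)) * \det (\matrix_(i, j) A (f i) j).
Proof.
have e (s : 'S_t) : \det (B *m A) = \sum_(f : {ffun 'I_t -> 'I_n})
    ((-1) ^+ s * \prod_i B i (f (s i))) * \det (\matrix_(i, j) A (f i) j).
  pose h (f : {ffun 'I_t -> 'I_n}) := [ffun i => f (s i)].
  have hI : injective h.
    move=> f g /ffunP e; apply/ffunP => i.
    by have := e ((s^-1)%g i); rewrite !ffunE permKV.
  rewrite det_mulmx_rows (reindex_inj hI) /=; apply: eq_bigr => f _.
  have -> : \matrix_(i, j) A (h f i) j = row_perm s (\matrix_(i, j) A (f i) j).
    by apply/matrixP => i j; rewrite !mxE ffunE.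
  rewrite row_permE det_mulmx det_perm mulrA [_ * (-1) ^+ _]mulrC.
  by congr (_ * _ * _); apply: eq_bigr => i _; rewrite ffunE.
have -> : (t`!)%:R * \det (B *m A) = \sum_(s : 'S_t) \det (B *m A).
  by rewrite sumr_const card_Sn mulr_natl.
rewrite (eq_bigr _ (fun s _ => e s)) exchange_big /=; apply: eq_bigr => f _.
rewrite -big_distrl /=; congr (_ * _); apply: eq_bigr => s _; congr (_ * _).
by apply: eq_bigr => i _; rewrite !mxE.
Qed.

End GramExpansion.

(** * Counting extensions of partial injections *)

Section InjectiveSums.
Variable F : fieldType.
Variables (T K : finType).
Implicit Types (f : {ffun T -> K}) (D : {ffun T -> K} -> F).

Definition fupd f i v : {ffun T -> K} := [ffun j => if j == i then v else f j].

(* [(f, v) |-> (f[i := v], f i)] is an involution. *)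
Lemma sum_fupd i D : \sum_f \sum_v D (fupd f i v) = #|K|%:R * \sum_f D f.
Proof.
rewrite pair_big /=.
pose h (p : {ffun T -> K} * K) := (fupd p.1 i p.2, p.1 i).
have hK : involutive h.
  move=> [f v]; rewrite /h /= ffunE eqxx; congr pair.
  by apply/ffunP => j; rewrite !ffunE; case: eqP => // ->.
rewrite (reindex_inj (inv_inj hK)) /=.
transitivity (\sum_(p : {ffun T -> K} * K) D p.1).
  apply: eq_bigr => -[f v] _ /=; congr D.
  by apply/ffunP => j; rewrite !ffunE; case: eqP => // ->.
rewrite -(pair_big xpredT xpredT (fun f v => D f)) /= big_distrr /=.
by apply: eq_bigr => f _; rewrite sumr_const mulr_natl.
Qed.

(** The sum runs over all functions, injective on [S] only. The values off [S] stay free, which is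
    why powers of [#|K|] appear in the next two lemmas. *)
Definition injsum (S : {set T}) D : F := \sum_(f : {ffun T -> K} | dinjectiveb f S) D f.

(** A function injective on [S] remains so on [i |: S] for exactly [#|K| - #|S|] values at [i]; the
    factor [#|K|] pays for drawing that value afresh. *)
Lemma injsum_setU1 (S : {set T}) i D : i \notin S ->
  (forall f v, D (fupd f i v) = D f) ->
  #|K|%:R * injsum (i |: S) D = (#|K| - #|S|)%:R * injsum S D.
Proof.
move=> iS Di; rewrite /injsum big_mkcond /= -(sum_fupd i).
rewrite [X in _ = _ * X]big_mkcond /= big_distrr /=; apply: eq_bigr => f _.
have fS v : {in S, fupd f i v =1 f}.
  by move=> j jS; rewrite ffunE; case: eqP => // ji; move: iS; rewrite -ji jS.
have cond v : dinjectiveb (fupd f i v) (i |: S) =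
    dinjectiveb f S && (v \notin f @: S).
  apply/dinjectiveP/andP => [I|[/dinjectiveP I vS]].
    split.
      apply/dinjectiveP => x y xS yS e; apply: I; rewrite ?finset.in_setU1 ?xS ?yS ?orbT //.
      by rewrite !fS.
    apply/negP => /imsetP[j jS vj]; move: (iS); suff -> : i = j by rewrite jS.
    apply: I; rewrite ?finset.in_setU1 ?eqxx ?jS ?orbT //.
    by rewrite (fS _ _ jS) ffunE eqxx.
  move=> x y; rewrite !finset.in_setU1 => /orP[/eqP->|xS] /orP[/eqP->|yS] //.
  - rewrite (fS _ _ yS) ffunE eqxx => e; case/negP: vS; apply/imsetP.
    by exists y.
  - rewrite (fS _ _ xS) ffunE eqxx => e; case/negP: vS; apply/imsetP.
    by exists x.
  - by rewrite !fS //; apply: I.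
under eq_bigr do rewrite cond Di.
case: ifP => [/dinjectiveP I|_] /=; last by rewrite big1 // mulr0.
rewrite -big_mkcond /= sumr_const mulr_natl; congr (_ *+ _).
rewrite -(card_in_imset I) -[X in (X - _)%N](cardsC (f @: S)) addnC addnK.
by apply: eq_card => v; rewrite !inE.
Qed.

Lemma injsum_extend (B S : {set T}) D : B \subset S ->
  (forall f i v, i \notin B -> D (fupd f i v) = D f) ->
  #|K|%:R ^+ (#|S| - #|B|) * injsum S D =
  ((#|K| - #|B|) ^_ (#|S| - #|B|))%:R * injsum B D.
Proof.
(* Induction on the number of indices of [S] outside [B], removed one at a time; each contributes
   one factor of the falling factorial. *)
move=> BS HD; have [k e] : {k | k = (#|S| - #|B|)%N} by exists (#|S| - #|B|)%N.
rewrite -e; elim: k => [|k IH] in S BS e *.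
  have -> : S = B.
    by apply/esym/eqP; rewrite eqEcard BS -subn_eq0 -e.
  by rewrite !mul1r.
have /properP[_ [i iS iB]] : B \proper S by rewrite properEcard BS -subn_gt0 -e.
have cS : #|S| = #|S :\ i|.+1 by rewrite (cardsD1 i) iS.
have BSi : B \subset S :\ i by rewrite finset.subsetD1 BS.
have ek : k = (#|S :\ i| - #|B|)%N.
  by apply: succn_inj; rewrite e cS subSn // subset_leq_card.
rewrite -(finset.setD1K iS) exprSr -mulrA injsum_setU1 ?finset.setD11 //; last by move=> *; apply: HD.
rewrite mulrCA IH // ffactnSr natrM -mulrA mulrCA; congr (_ * (_ * _)).
by rewrite -subnDA ek subnKC // subset_leq_card.
Qed.

End InjectiveSums.

(** * Mixed determinants and the coefficients of [\det (Psi + x *: Sig)] *)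

Section MixedDeterminants.
Variable F : numFieldType.

(** Let [S] be the set of rows taking the rank one term. The determinant then depends on [f] through
    its values on [S] only, and the falling factorial counts the injective extensions of such a
    partial map. *)
Lemma sum_inj_det_rank1D n t (B : 'M[F]_(t, n)) (A : 'M[F]_(n, t)) (Psi : 'M[F]_t) :
  (0 < n)%N ->
  \sum_(f : {ffun 'I_t -> 'I_n} | injectiveb f)
     \det (\matrix_(i, j) (B i (f i) * A (f i) j + Psi i j)) =
  \sum_(S : {set 'I_t})
     ((n - #|S|) ^_ (t - #|S|))%:R * \det (mixmx S (B *m A) Psi).
Proof.
move=> n0.
pose D (S : {set 'I_t}) (f : {ffun 'I_t -> 'I_n}) :=
  \det (mixmx S (\matrix_(i, j) (B i (f i) * A (f i) j)) Psi).
transitivity (\sum_(S : {set 'I_t}) injsum [set: 'I_t]%SET (D S)).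
  rewrite /injsum [RHS]exchange_big /=; apply: eq_big => [f|f _].
    by apply/injectiveP/dinjectiveP => [I x y _ _ /I //|I x y e]; apply: I; rewrite ?inE.
  by rewrite -det_addmx; congr (\det _); apply/matrixP => i j; rewrite !mxE.
apply: eq_bigr => S _.
have nz : n%:R ^+ (t - #|S|) != 0 :> F by rewrite expf_neq0 // pnatr_eq0 -lt0n.
apply: (mulfI nz).
have := @injsum_extend F _ 'I_n S [set: 'I_t]%SET (D S) (finset.subsetT _).
rewrite cardsT !card_ord => -> ; last first.
  move=> f i v iS; congr (\det _); apply/matrixP => k j; rewrite !mxE ffunE.
  by case: ifP => // kS; case: eqP => // ki; move: iS; rewrite -ki kS.
rewrite mulrCA; congr (_ * _).
(* Injectivity on [S] can now be dropped: once the factors [B i (f i)] are pulled out, a collision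
   gives two equal rows. *)
transitivity (\sum_f D S f).
  rewrite /injsum [RHS](bigID [pred f : {ffun 'I_t -> 'I_n} | dinjectiveb f S]) /=.
  rewrite [X in _ = _ + X]big1 ?addr0 // => f /dinjectivePn[x xS [y]].
  rewrite !inE => /andP[yx yS] e.
  have -> : D S f = \det (\matrix_(i, j)
      ((if i \in S then B i (f i) else 1) * (if i \in S then A (f i) j else Psi i j))).
    by congr (\det _); apply/matrixP => i j; rewrite !mxE; case: ifP; rewrite ?mul1r.
  have := det_scale_rows (fun i => if i \in S then B i (f i) else 1)
    (\matrix_(i, j) (if i \in S then A (f i) j else Psi i j)).
  set M1 := \matrix_(_, _) _ => e1; set M2 := \matrix_(_, _) _.
  have -> : M2 = M1 by apply/matrixP => i j; rewrite !mxE.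
  rewrite e1 (determinant_alternate yx) ?mulr0 // => j.
  by rewrite !mxE xS yS e.
(* In the sum over all [f], a row outside [S] is counted once for each of the [n] values of [f i],
   hence becomes [n] times the row of [Psi]. *)
have -> : n%:R ^+ (t - #|S|) = 1 ^+ #|S| * n%:R ^+ (t - #|S|) :> F.
  by rewrite expr1n mul1r.
rewrite -det_mixmxZ.
transitivity (\sum_(f : {ffun 'I_t -> 'I_n}) \det (\matrix_(i, j)
    (fun k i j => if i \in S then B i k * A k j else Psi i j) (f i) i j)).
  by apply: eq_bigr => f _; congr (\det _); apply/matrixP => i j; rewrite !mxE.
rewrite -(det_sum_rows (fun k i j => if i \in S then B i k * A k j else Psi i j)).
congr (\det _); apply/matrixP => i j; rewrite !mxE; case: ifP => _.
  by rewrite mul1r.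
by rewrite sumr_const card_ord mulr_natl.
Qed.

(** In characteristic zero the integers 1, 2, 3, ... would be too many roots of [p - q]. The value
    at 0 is left out because the eigenvalue formula below divides by [x]. *)
Lemma eq_poly_nonzero (p q : {poly F}) :
  (forall x, x != 0 -> p.[x] = q.[x]) -> p = q.
Proof.
move=> e; apply/eqP; rewrite -subr_eq0; apply/negPn/negP => nz.
have := @max_poly_roots _ (p - q) [seq (k.+1)%:R | k <- iota 0 (size (p - q))] nz.
rewrite size_map size_iota ltnn => H; suff : false by []; apply: H.
  by apply/allP => _ /mapP[k _ ->]; rewrite rootE !hornerE e ?subrr ?pnatr_eq0.
rewrite map_inj_uniq ?iota_uniq // => x y /eqP; rewrite eqr_nat => /eqP [//].
Qed.

(** The coefficient of degree [k] in [\det (Psi + x *: Sig)] collects the sets [S] of cardinality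
    [k], so a weight depending on [#|S|] alone acts on coefficients. *)
Lemma sum_mixmx_coef t (Sig Psi : 'M[F]_t) (p : {poly F}) (phi : nat -> F) :
  (forall x, x != 0 -> \det (Psi + x *: Sig) = p.[x]) ->
  \sum_(S : {set 'I_t}) phi #|S| * \det (mixmx S Sig Psi) =
  \sum_(k < t.+1) phi k * p`_k.
Proof.
move=> Hp; pose q := \sum_(S : {set 'I_t}) \det (mixmx S Sig Psi) *: 'X^#|S|.
have -> : p = q.
  apply: eq_poly_nonzero => x x0; rewrite -Hp // addrC det_addmx horner_sum.
  apply: eq_bigr => S _.
  by rewrite -[in LHS](scale1r Psi) det_mixmxZ expr1n mulr1 !hornerE mulrC.
have cS (S : {set 'I_t}) : (#|S| < t.+1)%N.
  by rewrite ltnS (leq_trans (max_card _)) ?card_ord.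
under [RHS]eq_bigr => k _ do rewrite coef_sum big_distrr.
rewrite exchange_big /=; apply: eq_bigr => S _.
rewrite (bigD1 (Ordinal (cS S))) //= coefZ coefXn eqxx mulr1 big1 ?addr0 // => k.
rewrite coefZ coefXn -val_eqE /= => /negPf ->.
by rewrite !mulr0.
Qed.

(* [det (1 + x A) = (-x)^n det (-1/x - A)]: the reverse of the characteristic
   polynomial has the zero roots removed. *)
Lemma det_1Dscale_eigs n (A : 'M[F]_n) (s : seq F) (x : F) : x != 0 ->
  (size s <= n)%N ->
  char_poly A = 'X^(n - size s) * \prod_(a <- s) ('X - a%:P) ->
  \det (1%:M + x *: A) = (\prod_(a <- s) (1 + a *: 'X)).[x].
Proof.
move=> x0 sn e.
have := congr1 (horner^~ (- x^-1)) e; rewrite /char_poly -horner_evalE -det_map_mx.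
have -> : map_mx (horner_eval (- x^-1)) (char_poly_mx A) = (- x^-1)%:M - A.
  by apply/matrixP => i j; rewrite !mxE /horner_eval /= !hornerE; case: eqP; rewrite ?hornerE.
have -> : 1%:M + x *: A = - x *: ((- x^-1)%:M - A).
  by rewrite scalerBr scale_scalar_mx mulrNN divff // scaleNr opprK.
rewrite detZ => ->; rewrite hornerM hornerXn !horner_prod.
rewrite -{1}(subnK sn) exprD mulrACA -exprMn mulrNN divff // expr1n mul1r.
have -> : (- x) ^+ size s = \prod_(a <- s) (- x).
  by rewrite big_const_seq count_predT -Monoid.iteropE.
rewrite -big_split /=; apply: eq_bigr => a _.
by rewrite !hornerE; field.
Qed.

End MixedDeterminants.

(** * Factorization of the matrix in the numerator of J *)

Section BidiagonalVandermonde.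
Variable F : idomainType.

(** The companion matrix of the monic polynomial with lower coefficients [p], plus the diagonal
    matrix of [a]. If [x] is a root, the row of powers of [x] times column [j] is
    [(a j + x) * x ^+ j]. *)
Definition bidiag_companion L (a p : nat -> F) : 'M[F]_L :=
  \matrix_(i < L, j < L) (a j *+ (i == j :> nat) + (i == j.+1 :> nat)%:R
     - p i *+ (j.+1 == L :> nat)).

(** The first row has only its two end entries [a 0] and [- p 0]. The minor of the first has the
    same shape with shifted sequences, and induction applies. *)
Lemma det_bidiag_companion L (a p : nat -> F) :
  \det (bidiag_companion L.+1 a p) =
  \prod_(l < L.+1) a l +
  \sum_(m < L.+1) (-1) ^+ (L.+1 - m) * p m * \prod_(l < m) a l.
Proof.
elim: L a p => [|L IH] a p.
  rewrite det_mx11 !mxE /= !big_ord1 big_ord0 /= subn0 mulr1 expr1.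
  by rewrite mulr1n addr0 mulN1r.
rewrite (expand_det_row _ ord0) [LHS]big_ord_recl [X in _ + X = _]big_ord_recr /=.
rewrite [X in _ + (X + _) = _]big1 => [|i _]; last first.
  rewrite !mxE /= /bump /= ?add1n eqSS ltn_eqF ?ltnS ?ltn_ord //.
  by rewrite !mulr0n addr0 subr0 mul0r.
rewrite add0r !mxE /= /bump /= eqxx !mulr1n subr0 addr0 add0r sub0r.
rewrite /cofactor /= mul1r.
have -> : row' ord0 (col' ord0 (bidiag_companion L.+2 a p)) =
    bidiag_companion L.+1 (fun k => a k.+1) (fun k => p k.+1).
  by apply/matrixP => i j; rewrite !mxE /= /bump /= ?add1n !eqSS.
rewrite IH.
set U := row' _ _.
(* Without the first row and last column, the subdiagonal ones move to the diagonal and [a] lies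
   above it: the minor is upper unitriangular. *)
have -> : \det U = 1.
  rewrite -det_tr det_trig.
    apply: big1 => i _; rewrite !mxE /= /bump /= ?add1n [(L.+1 <= i)%N]leqNgt ltn_ord.
    rewrite add0n eqxx gtn_eqF // mulr0n add0r eqSS ltn_eqF ?ltn_ord //.
    by rewrite subr0.
  apply/is_trig_mxP => i j ij; rewrite !mxE /= /bump /= ?add1n [(L.+1 <= i)%N]leqNgt ltn_ord.
  rewrite add0n gtn_eqF ?ltnS ?(ltnW ij) // mulr0n add0r !eqSS gtn_eqF //.
  by rewrite ltn_eqF ?ltn_ord // subr0.
rewrite mulr1 mulrDr -addrA [in RHS]big_ord_recl /=; congr (_ + _).
rewrite [in RHS]big_ord_recl /= big_ord0 mulr1 addrC; congr (_ + _).
  by rewrite /bump add0n add1n subn0 [in RHS]exprS mulN1r !mulNr mulrC.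
rewrite big_distrr /=; apply: eq_bigr => m _.
by rewrite big_ord_recl /= /bump /= ?add1n subSS mulrCA.
Qed.

Lemma coef_prod_1DscaleX_gt (s : seq F) k : (size s < k)%N ->
  (\prod_(a <- s) (1 + a *: 'X))`_k = 0.
Proof.
elim: s k => [|a s IH] [|k] //= sk; first by rewrite big_nil coef1.
rewrite big_cons mulrDl mul1r -scalerAl coefD coefZ coefXM /= !IH ?mulr0 ?addr0 //.
exact: ltn_trans sk.
Qed.

(** Both products have the elementary symmetric functions of [s] as coefficients, in reverse order
    and up to sign. *)
Lemma coef_prod_1DscaleX (s : seq F) m : (m <= size s)%N ->
  (\prod_(a <- s) (1 + a *: 'X))`_(size s - m) =
  (-1) ^+ (size s - m) * (\prod_(a <- s) ('X - a%:P))`_m.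
Proof.
elim: s m => [|a s IH] m /=; first by rewrite leqn0 => /eqP ->; rewrite !big_nil mul1r.
rewrite !big_cons mulrDl mul1r -scalerAl coefD coefZ coefXM.
rewrite mulrBl coefB coefXM coefCM leq_eqVlt => /orP[/eqP->|].
  rewrite subnn eqxx mulr0 addr0 /= expr0 mul1r.
  have -> : (\prod_(j <- s) ('X - j%:P))`_(size s).+1 = 0.
    by rewrite nth_default // size_prod_XsubC.
  by rewrite mulr0 subr0 -(subnn (size s)) IH // subnn mul1r.
rewrite ltnS => ms; rewrite subSn //= IH // exprS mulN1r mulNr.
case: m ms => [|m] ms /=.
  by rewrite subn0 coef_prod_1DscaleX_gt //; ring.
rewrite -subSn // subSS IH ?(ltnW ms) // -[(size s - m)%N]prednK ?subn_gt0 //.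
rewrite -subnS exprS.
by ring.
Qed.

(** The matrix is the transposed Vandermonde matrix times [bidiag_companion] of the polynomial whose
    roots are the coordinates of [x]. *)
Lemma det_bidiag_vandermonde L (a : nat -> F) (x : 'rV[F]_L)
    (s := [seq x 0 i | i : 'I_L]) :
  \det (\matrix_(i < L, j < L) ((a j + x 0 i) * x 0 i ^+ j)) =
  \det (Vandermonde L x) *
  \sum_(k < L.+1) (\prod_(b <- s) (1 + b *: 'X))`_k * \prod_(l < L - k) a l.
Proof.
case: L => [|L] in x s *.
  by rewrite !det_mx00 big_ord1 big_ord0 /s big_image /= big_ord0 coef1 !mulr1.
have ss : size s = L.+1 by rewrite size_image card_ord.
pose P := \prod_(b <- s) ('X - b%:P).
have Pm : P \is monic by apply: monic_prod_XsubC.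
have sP : size P = L.+2 by rewrite size_prod_XsubC ss.
have PL : P`_L.+1 = 1 by move/monicP: Pm; rewrite /lead_coef sP.
have cE m : (m <= L.+1)%N -> (\prod_(b <- s) (1 + b *: 'X))`_m =
    (-1) ^+ m * P`_(L.+1 - m).
  by move=> mL; have := coef_prod_1DscaleX (leq_subr m (size s)); rewrite ss subKn.
have -> : \sum_(k < L.+2) (\prod_(b <- s) (1 + b *: 'X))`_k * \prod_(l < L.+1 - k) a l
    = \det (bidiag_companion L.+1 a (fun m => P`_m)).
  rewrite det_bidiag_companion (reindex_inj rev_ord_inj) big_ord_recr /= addrC.
  congr (_ + _).
    by rewrite subnn cE // subn0 PL !mul1r.
  by apply: eq_bigr => m _; rewrite subSS cE ?leq_subr // ?subKn // ltnW.
rewrite -[\det (Vandermonde _ _)]det_tr -det_mulmx; congr (\det _).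
apply/matrixP => i j; rewrite !mxE.
under eq_bigr do rewrite !mxE mulrBr mulrDr.
rewrite big_split big_split /= mulrDl -addrA; congr (_ + _).
  rewrite (bigD1 j) //= eqxx mulr1n mulrC big1 ?addr0 // => k.
  by rewrite -val_eqE /= => /negPf ->; rewrite mulr0n mulr0.
(* In the last column the top power of [x 0 i] is rewritten through the lower ones, using that
   [x 0 i] is a root of [P]. *)
have [jL|jL] := eqVneq j.+1 L.+1.
  rewrite big1 ?add0r => [|k _]; last by rewrite jL ltn_eqF ?ltn_ord // mulr0.
  have : root P (x 0 i).
    by rewrite root_prod_XsubC; apply/fintype.imageP; exists i.
  rewrite rootE horner_coef sP big_ord_recr /= PL mul1r addrC addr_eq0 => /eqP.
  rewrite -exprS jL => ->; rewrite -sumrN; apply: eq_bigr => k _.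
  by rewrite mulr1n mulrC.
have jL' : (j.+1 < L.+1)%N by rewrite ltn_neqAle jL ltn_ord.
rewrite [X in _ + X]big1 ?addr0 => [|k _]; last by rewrite mulr0n mulr0 oppr0.
rewrite (bigD1 (Ordinal jL')) //= eqxx mulr1 exprS big1 ?addr0 // => k.
by rewrite -val_eqE /= => /negPf ->; rewrite mulr0.
Qed.

End BidiagonalVandermonde.

(** * The function J *)

Section Jfunction.
Variable R : realType.

Lemma prod_shift_ffact (q L m : nat) : (L <= q)%N ->
  \prod_(l < m) (q%:R - L%:R + (l.+1)%:R : R) = ((q - L + m) ^_ m)%:R.
Proof.
move=> Lq; elim: m => [|m IH]; first by rewrite big_ord0 ffactn0.
rewrite big_ord_recr /= IH -natrB // -natrD addnS ffactSS natrM mulrC.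
by [].
Qed.

Lemma det_DeltaE q L (x : 'rV[R]_L) (s := [seq x 0 i | i : 'I_L]) : (L <= q)%N ->
  \det (Delta q x) = Vand x *
   \sum_(k < L.+1) (\prod_(b <- s) (1 + b *: 'X))`_k * ((q - k) ^_ (L - k))%:R.
Proof.
move=> Lq.
have -> : Delta q x = \matrix_(i < L, j < L)
    ((q%:R - L%:R + (j.+1)%:R + x 0 i) * x 0 i ^+ j).
  by apply/matrixP => i j; rewrite !mxE.
rewrite (det_bidiag_vandermonde (fun j => q%:R - L%:R + (j.+1)%:R)).
rewrite det_Vandermonde; congr (_ * _); apply: eq_bigr => k _; congr (_ * _).
have kL : (k <= L)%N by rewrite -ltnS.
by rewrite prod_shift_ffact // addnBA // subnK.
Qed.

Lemma continuous_coef_prod L (k : nat) (r : seq 'I_L) :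
  continuous (fun x : 'rV[R]_L => (\prod_(i <- r) (1 + x 0 i *: 'X))`_k).
Proof.
elim: r k => [|i r IH] k x.
  by under eq_fun do rewrite big_nil; apply: cst_continuous.
under eq_fun do rewrite big_cons mulrDl mul1r -scalerAl coefD coefZ coefXM.
have FF : Filter (nbhs x) by exact: (@nbhs_filter _ (x : 'rV[R]_L)).
apply: (cvgD (FF := FF)); first exact: IH.
apply: (cvgM (FF := FF)); first exact: coord_continuous.
by case: k => [|k]; [apply: cvg_cst | exact: (IH k x)].
Qed.

(** The points [x 0 i + e * i] have distinct coordinates for small [e != 0], so the filter defining
    [Jfun] is proper and its limit is unique. *)
Lemma Vand_neq0_proper L (x : 'rV[R]_L) :
  ProperFilter (within [set y : 'rV[R]_L | Vand y != 0] (nbhs x)).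
Proof.
apply: Build_ProperFilter_ex => B /= HB.
pose line (e : R) : 'rV[R]_L := \row_i (x 0 i + e * i%:R).
have line0 : line 0 = x by apply/rowP => i; rewrite mxE mul0r addr0.
have cl : line @ 0^' --> x.
  move=> A /= [Q HQ QA]; apply: filterS QA _ => /=.
  have : \forall e \near 0^', forall ij : 'I_1 * 'I_L, Q ij.1 ij.2 (line e ij.1 ij.2).
    apply: filter_forall => -[i j] /=.
    have cij : (fun e : R => line e i j) @ 0^' --> x i j.
      have -> : x i j = x 0 j + 0 * j%:R by rewrite mul0r addr0 ord1.
      under eq_fun do rewrite mxE.
      apply: cvgD; first exact: cvg_cst.
      by apply: cvgM; [apply: cvg_within | apply: cvg_cst].
    exact: cij _ (HQ i j).
  by apply: filterS => e H i j; exact: (H (i, j)).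
have nz : \forall e \near 0^', Vand (line e) != 0.
  have : \forall e \near 0^', forall ij : 'I_L * 'I_L, (ij.1 < ij.2)%N ->
      line e 0 ij.2 - line e 0 ij.1 != 0.
    apply: filter_forall => -[i j] /=.
    have [ij|] := ltnP i j; last by move=> _; near=> e.
    pose c := x 0 j - x 0 i; pose d : R := j%:R - i%:R.
    have d0 : d != 0 by rewrite subr_eq0 eqr_nat gtn_eqF.
    (* Coordinates [i] and [j] collide only at [e = - c / d]; if this is 0, the punctured
       neighbourhood already excludes it. *)
    have : \forall e \near 0^', e != - c / d.
      have [->|c0] := eqVneq c 0.
        by rewrite oppr0 mul0r; exact: nbhs_dnbhs_neq.
      apply: nbhs_dnbhs.
      have : \forall e \near (0 : R), e + c / d != 0.
        have cd : (e + c / d) @[e --> (0 : R)] --> c / d.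
          by rewrite -[X in _ --> X]add0r; apply: cvgD; [exact: cvg_id | exact: cvg_cst].
        by apply: (cvgr_neq0 _ cd); rewrite mulf_neq0 // invr_eq0.
      by apply: filterS => e; rewrite addr_eq0 mulNr.
    apply: filterS => e ne _; rewrite !mxE; apply: contraNneq ne => e0.
    apply/eqP; apply: (mulIf d0); rewrite divfK //; apply/eqP; rewrite -subr_eq0 opprK.
    by rewrite /c /d -[X in _ == X]e0; apply/eqP; ring.
  apply: filterS => e H; rewrite /Vand; apply/prodf_neq0 => i _.
  by apply/prodf_neq0 => j ij; exact: (H (i, j)).
near (0 : R)^' => e; exists (line e); near: e.
by apply: filterS2 nz (cl _ HB) => e Ve; apply.
Unshelve. all: by end_near. Qed.

(** Where the Vandermonde product is nonzero the ratio equals a polynomial in the coordinates; by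
    continuity the limit is the value of this polynomial at [s], repeated entries included. *)
Lemma JfunE (q : nat) (s : seq R) : (size s <= q)%N ->
  Jfun q s = \sum_(k < (size s).+1)
    (\prod_(a <- s) (1 + a *: 'X))`_k * ((q - k) ^_ (size s - k))%:R.
Proof.
move=> sq; set L := size s; pose x0 : 'rV[R]_L := \row_(i < L) s`_i.
pose g (x : 'rV[R]_L) := \sum_(k < L.+1)
    (\prod_(i < L) (1 + x 0 i *: 'X))`_k * ((q - k) ^_ (L - k))%:R.
have -> : \sum_(k < L.+1) (\prod_(a <- s) (1 + a *: 'X))`_k * ((q - k) ^_ (L - k))%:R = g x0.
  apply: eq_bigr => k _; congr (nth 0 (polyseq _) k * _).
  rewrite (big_nth 0) big_mkord.
  by apply: eq_bigr => i _; rewrite mxE.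
rewrite /Jfun -/L -/x0.
have PF := Vand_neq0_proper x0.
apply: cvg_lim => //.
have gE : {near (within [set y : 'rV[R]_L | Vand y != 0] (nbhs x0)),
    g =1 Jratio q (L:=L)}.
  rewrite near_withinE; near=> x => /= Vx.
  rewrite /Jratio det_DeltaE // mulrAC mulfV // mul1r.
  by apply: eq_bigr => k _; rewrite big_image.
have cg : {for x0, continuous g}.
  apply: continuous_big => [|k _ x]; first exact: add_continuous.
  have FF : Filter (nbhs x) by exact: (@nbhs_filter _ (x : 'rV[R]_L)).
  by apply: (cvgM (FF := FF)); [apply: continuous_coef_prod | apply: cvg_cst].
apply: cvg_trans (near_eq_cvg gE) _.
by apply: cvg_trans cg; apply: cvg_app; exact: cvg_within.
Unshelve. all: by end_near. Qed.

End Jfunction.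

(** * Independence and expectation *)

Section Transfer.
Variable R : realType.
Import HBNNSimple.

Section OneSide.
Context {d} {T : measurableType d} {d'} {S : measurableType d'}.
Variables (mu : {measure set T -> \bar R}) (X : T -> S) (h : T -> R).
Hypotheses (mX : measurable_fun setT X) (mh : measurable_fun setT h).
Hypothesis h0 : forall w, 0 <= h w.

(** A simple function is a finite combination of indicators of its level sets. The weight [h] will
    be a product of other variables, a constant, or a density. *)
Lemma integral_nnsfun_compM (phi : {nnsfun S >-> R}) :
  (\int[mu]_w (phi (X w) * h w)%:E =
   \sum_(y \in range phi)
     (y%:E * \int[mu]_(w in X @^-1` (phi @^-1` [set y])) (h w)%:E))%E.
Proof.
have mpre y : measurable (X @^-1` (phi @^-1` [set y])).
  by rewrite -[X in measurable X]setTI; apply: mX => //; exact: measurable_sfunP.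
transitivity (\int[mu]_w \sum_(y \in range phi)
   (y%:E * (\1_(phi @^-1` [set y]) (X w) * h w)%:E))%E.
  apply: eq_integral => w _.
  rewrite EFinM (fimfunE phi) -fsumEFin; last exact: fimfunP.
  rewrite ge0_mule_fsuml; last by move=> y; exact: (nnfun_muleindic_ge0 phi).
  by apply: eq_fsbigr => y _; rewrite -!EFinM mulrA.
have m1 y : measurable_fun setT (fun w => \1_(phi @^-1` [set y]) (X w) * h w : R).
  apply: measurable_funM => //; apply: (measurableT_comp _ mX).
  by apply: measurable_indic; exact: measurable_sfunP.
rewrite ge0_integral_fsum //; last 2 first.
- by move=> y; apply: emeasurable_funM => //; exact/measurable_EFinP.
- move=> y w _; rewrite EFinM muleA.
  by apply: mule_ge0; [exact: (nnfun_muleindic_ge0 phi)|rewrite lee_fin].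
apply: eq_fsbigr => y; rewrite inE => -[s _ <-].
rewrite ge0_integralZl_EFin //; last 2 first.
- by move=> w _; rewrite lee_fin mulr_ge0 // indicE.
- exact/measurable_EFinP.
congr (_ * _)%E; rewrite [in RHS]integral_mkcond; apply: eq_integral => w _.
rewrite patchE indicE; case: ifPn; rewrite ?inE ?notin_setE /= => H.
  by rewrite mem_set //= mul1r.
by rewrite memNset //= mul0r.
Qed.

End OneSide.

(* Both sides are limits of the same combinations of the integrals over the
   level sets of a simple function. *)
Lemma ge0_integral_transfer {d1} {T1 : measurableType d1} {d2} {T2 : measurableType d2}
  {d'} {S : measurableType d'}
  (mu1 : {measure set T1 -> \bar R}) (X1 : T1 -> S) (h1 : T1 -> R)
  (mu2 : {measure set T2 -> \bar R}) (X2 : T2 -> S) (h2 : T2 -> R) (f : S -> R) :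
  measurable_fun setT X1 -> measurable_fun setT h1 -> (forall w, 0 <= h1 w) ->
  measurable_fun setT X2 -> measurable_fun setT h2 -> (forall w, 0 <= h2 w) ->
  (forall A, measurable A -> \int[mu1]_(w in X1 @^-1` A) (h1 w)%:E =
                             \int[mu2]_(w in X2 @^-1` A) (h2 w)%:E)%E ->
  measurable_fun setT f -> (forall s, 0 <= f s) ->
  (\int[mu1]_w (f (X1 w) * h1 w)%:E = \int[mu2]_w (f (X2 w) * h2 w)%:E)%E.
Proof.
move=> mX1 mh1 h10 mX2 mh2 h20 H mf f0.
have [g [gnd gf]] := @approximation _ S R setT measurableT (EFin \o f)
  (iffRL (measurable_EFinP _ _) mf) (fun t _ => f0 t).
have side d (T : measurableType d) (mu : {measure set T -> \bar R}) (X : T -> S)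
    (h : T -> R) : measurable_fun setT X -> measurable_fun setT h ->
    (forall w, 0 <= h w) ->
    (\int[mu]_w (g n (X w) * h w)%:E @[n --> \oo] --> \int[mu]_w (f (X w) * h w)%:E)%E.
  move=> mX mh h0.
  have -> : (\int[mu]_w (f (X w) * h w)%:E =
      \int[mu]_w limn (fun n => (g n (X w) * h w)%:E))%E.
    apply: eq_integral => w _; apply/esym/cvg_lim => //.
    apply: cvg_EFin; first by near=> n.
    rewrite /comp /=; apply: cvgM; last exact: cvg_cst.
    have := gf (X w) I; exact: fine_cvg.
  apply: (@cvg_monotone_convergence _ T R mu setT measurableT
    (fun n w => (g n (X w) * h w)%:E)).
  - move=> n; apply/measurable_EFinP; apply: measurable_funM => //.
    exact: (measurableT_comp _ mX).
  - by move=> n w _; rewrite lee_fin mulr_ge0.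
  - move=> w _ n m nm; rewrite lee_fin ler_wpM2r //.
    by have /lefP := gnd _ _ nm; apply.
have c1 := side _ _ mu1 X1 h1 mX1 mh1 h10.
have c2 := side _ _ mu2 X2 h2 mX2 mh2 h20.
suff e : (fun n => \int[mu1]_w (g n (X1 w) * h1 w)%:E)%E =
    (fun n => \int[mu2]_w (g n (X2 w) * h2 w)%:E)%E.
  by rewrite e in c1; exact: (cvg_unique _ c1 c2).
apply/funext => n; rewrite !integral_nnsfun_compM //.
apply: eq_fsbigr => y _; rewrite H //; exact: measurable_sfunP.
Unshelve. all: by end_near. Qed.

End Transfer.

(** * Products of functions of independent variables *)

Section Independence.
Context {R : realType} {d : measure_display} {Omega : measurableType d}.
Variables (P : probability Omega R) (I : finType) (X : I -> Omega -> R).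
Hypothesis mX : forall i, measurable_fun setT (X i).
Hypothesis indX : mutually_independent P X.

Lemma measurable_prod_comp (Q : pred I) (f : I -> R -> R) :
  (forall i, measurable_fun setT (f i)) ->
  measurable_fun setT (fun w => \prod_(i | Q i) f i (X i w)).
Proof.
move=> mf; under eq_fun do rewrite -big_filter.
apply: measurable_prod => i _; exact: (measurableT_comp (mf i) (mX i)).
Qed.

Lemma measurable_preimageX i (A : set R) : measurable A -> measurable (X i @^-1` A).
Proof. by move=> mA; rewrite -[X in measurable X]setTI; apply: mX. Qed.

Lemma integral_indicX i (A : set R) : measurable A ->
  (\int[P]_w (\1_A (X i w))%:E = P (X i @^-1` A))%E.
Proof.
move=> mA; have := integral_indic P measurableT (measurable_preimageX i mA).
by rewrite setIT => <-; apply: eq_integral => w _; rewrite !indicE.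
Qed.

(* One function at a time is generalized from an indicator to an arbitrary
   nonnegative measurable function; [J] collects those already generalized. *)
Lemma ge0_integral_prod_aux (J : {set I}) (f : I -> R -> R) (m : I -> R) :
  (forall i, measurable_fun setT (f i)) -> (forall i x, 0 <= f i x) ->
  (forall i, \int[P]_w (f i (X i w))%:E = (m i)%:E)%E ->
  (forall i, i \notin J -> exists2 A, measurable A & f i = \1_A) ->
  (\int[P]_w (\prod_i f i (X i w))%:E = (\prod_i m i)%:E)%E.
Proof.
have [n] := ubnP #|J|; elim: n => // n IH in J f m *; rewrite ltnS => Jn mf f0 fm fJ.
(* With [J] empty every function is an indicator and the claim is mutual independence itself. *)
have [J0|[v vJ]] := set_0Vmem J.
  have /choice[A HA] : forall i, exists A : set R, measurable A /\ f i = \1_A.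
    by move=> i; have [|A mA fA] := fJ i; [rewrite J0 inE | exists A].
  have := indX [set: I]%SET (fun i => (HA i).1).
  have -> : (\prod_(i in [set: I]%SET) P (X i @^-1` A i) = (\prod_i m i)%:E)%E.
    rewrite -prodEFin; apply: eq_big => [i|i _]; first by rewrite inE.
    by rewrite -fm (HA i).2 integral_indicX //; exact: (HA i).1.
  move=> <-; set B := \bigcap_(_ in _) _.
  have mB : measurable B.
    apply: fin_bigcap_measurable; first exact: finite_finset.
    by move=> i _; apply: measurable_preimageX; exact: (HA i).1.
  rewrite -[RHS](_ : \int[P]_w (\1_B w)%:E = _)%E; last by rewrite integral_indic // setIT.
  apply: eq_integral => w _; congr EFin.
  rewrite indicE; case: (boolP (w \in B)); rewrite ?inE ?notin_setE => HB.
    rewrite big1 // => i _; rewrite (HA i).2 indicE mem_set //.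
    by apply: HB; rewrite /= inE.
  have [i Hi] : exists i, ~ A i (X i w).
    by apply/existsNP => H; apply: HB => i _; apply: H.
  by rewrite (bigD1 i) //= (HA i).2 indicE memNset // mul0r.
pose c := \prod_(i | i != v) m i.
have m0 i : 0 <= m i.
  by rewrite -lee_fin -fm integral_ge0 // => w _; rewrite lee_fin.
have c0 : 0 <= c by apply: prodr_ge0.
pose h w := \prod_(i | i != v) f i (X i w).
have mh : measurable_fun setT h by exact: measurable_prod_comp.
have h0 w : 0 <= h w by apply: prodr_ge0.
transitivity (\int[P]_w (f v (X v w) * h w)%:E)%E.
  by apply: eq_integral => w _; rewrite (bigD1 v).
(* The product [h] of the other factors is replaced by its mean [c]. It suffices to compare
   integrals over the events [X v \in A], where [f v] becomes an indicator and the induction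
   hypothesis for [J :\ v] applies. *)
rewrite (@ge0_integral_transfer R _ Omega _ Omega _ R P (X v) h P (X v) (cst c)) //.
  under eq_integral do rewrite EFinM muleC.
  rewrite ge0_integralZl_EFin //.
  - by rewrite fm -EFinM [in RHS](bigD1 v) //= mulrC.
  - by move=> w _; rewrite lee_fin.
  - by apply/measurable_EFinP; apply: (measurableT_comp (mf v) (mX v)).
move=> A mA.
have mpre := measurable_preimageX v mA.
transitivity (c%:E * P (X v @^-1` A))%E; last by rewrite -integral_cst.
rewrite integral_mkcond.
pose f' i : R -> R := if i == v then \1_A else f i.
have [p Hp] : exists p, P (X v @^-1` A) = p%:E.
  by exists (fine (P (X v @^-1` A))); rewrite fineK // fin_num_measure.
pose m' i := if i == v then p else m i.
transitivity (\int[P]_w (\prod_i f' i (X i w))%:E)%E.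
  apply: eq_integral => w _; rewrite (bigD1 v) //= /f' eqxx patchE indicE.
  have -> : \prod_(i | i != v) (if i == v then \1_A else f i) (X i w) = h w.
    by apply: eq_bigr => i /negPf ->.
  case: ifPn; rewrite ?inE ?notin_setE /= => H; first by rewrite mem_set // mul1r.
  by rewrite memNset // mul0r.
rewrite (IH (J :\ v)%SET f' m').
- rewrite (bigD1 v) //= /m' eqxx Hp -EFinM mulrC; congr (_ * _)%:E.
  by apply: eq_bigr => i /negPf ->.
- by rewrite (cardsD1 v) vJ in Jn.
- by move=> i; rewrite /f'; case: eqP => // _; exact: measurable_indic.
- by move=> i x; rewrite /f'; case: eqP => // _; rewrite indicE.
- move=> i; rewrite /f' /m'; case: eqP => [->|_ //].
  by rewrite -Hp integral_indicX.
- move=> i; rewrite in_setD1 negb_and negbK /f'.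
  by case: eqP => [_ _|_ /= /fJ //]; exists A.
Qed.

Lemma ge0_integral_prod (f : I -> R -> R) (m : I -> R) :
  (forall i, measurable_fun setT (f i)) -> (forall i x, 0 <= f i x) ->
  (forall i, \int[P]_w (f i (X i w))%:E = (m i)%:E)%E ->
  (\int[P]_w (\prod_i f i (X i w))%:E = (\prod_i m i)%:E)%E.
Proof. by move=> mf f0 fm; apply: (@ge0_integral_prod_aux [set: I]%SET) => // i; rewrite inE. Qed.

End Independence.

(** * Real and complex expectations *)

Section Expectation.
Context {R : realType} {d : measure_display} {Omega : measurableType d}.
Variable P : probability Omega R.
Local Notation C := R[i].

Definition summable_rv (g : Omega -> R) := P.-integrable setT (EFin \o g).
Definition Ex (g : Omega -> R) : R := \int[P]_w g w.

Lemma ExE g : summable_rv g -> (\int[P]_w (g w)%:E = (Ex g)%:E)%E.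
Proof. by move=> ig; rewrite /Ex /Rintegral fineK // integrable_fin_num. Qed.

Lemma summable_cst (c : R) : summable_rv (fun=> c).
Proof. exact: finite_measure_integrable_cst. Qed.

Lemma Ex_cst (c : R) : Ex (fun=> c) = c.
Proof. by rewrite /Ex Rintegral_cst //= probability_setT mulr1. Qed.

Lemma summableD f g : summable_rv f -> summable_rv g ->
  summable_rv (fun w => f w + g w).
Proof. by move=> sf sg; exact: (integrableD measurableT sf sg). Qed.

Lemma summableZ (c : R) f : summable_rv f -> summable_rv (fun w => c * f w).
Proof. by move=> sf; exact: (integrableZl measurableT c sf). Qed.

Lemma ExD f g : summable_rv f -> summable_rv g ->
  Ex (fun w => f w + g w) = Ex f + Ex g.
Proof. by move=> sf sg; rewrite /Ex RintegralD. Qed.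

Lemma ExZ (c : R) f : summable_rv f -> Ex (fun w => c * f w) = c * Ex f.
Proof. by move=> sf; rewrite /Ex RintegralZl. Qed.

Lemma summable_sum (K : Type) (s : seq K) (g : K -> Omega -> R) :
  (forall k, summable_rv (g k)) -> summable_rv (fun w => \sum_(k <- s) g k w).
Proof.
move=> sg; elim: s => [|k s IH]; first by under eq_fun do rewrite big_nil; exact: summable_cst.
by under eq_fun do rewrite big_cons; apply: summableD.
Qed.

Lemma Ex_sum (K : Type) (s : seq K) (g : K -> Omega -> R) :
  (forall k, summable_rv (g k)) ->
  Ex (fun w => \sum_(k <- s) g k w) = \sum_(k <- s) Ex (g k).
Proof.
move=> sg; elim: s => [|k s IH].
  by under eq_fun do rewrite big_nil; rewrite Ex_cst big_nil.
under eq_fun do rewrite big_cons.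
by rewrite ExD ?IH ?big_cons //; exact: summable_sum.
Qed.

Section IndependentProducts.
Variables (I : finType) (X : I -> Omega -> R).
Hypothesis mX : forall i, measurable_fun setT (X i).
Hypothesis indX : mutually_independent P X.

Lemma ge0_expectation_prod (f : I -> R -> R) :
  (forall i, measurable_fun setT (f i)) -> (forall i x, 0 <= f i x) ->
  (forall i, summable_rv (f i \o X i)) ->
  summable_rv (fun w => \prod_i f i (X i w)) /\
  Ex (fun w => \prod_i f i (X i w)) = \prod_i Ex (f i \o X i).
Proof.
move=> mf f0 sf.
have e := ge0_integral_prod mX indX mf f0 (fun i => ExE (sf i)).
split; last by rewrite {1}/Ex /Rintegral e.
apply/integrableP; split.
  by apply/measurable_EFinP; exact: measurable_prod_comp.
under eq_integral do rewrite /= ger0_norm ?prodr_ge0 //.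
by rewrite e ltry.
Qed.

(** Each factor is split into positive and negative parts; distributing the product leaves signed
    products of nonnegative functions. *)
Lemma expectation_prod (f : I -> R -> R) :
  (forall i, measurable_fun setT (f i)) ->
  (forall i, summable_rv (f i \o X i)) ->
  summable_rv (fun w => \prod_i f i (X i w)) /\
  Ex (fun w => \prod_i f i (X i w)) = \prod_i Ex (f i \o X i).
Proof.
move=> mf sf.
pose g i (b : bool) := if b then (f i)^\+ else (f i)^\-.
pose e (b : bool) : R := if b then 1 else -1.
have mg i b : measurable_fun setT (g i b).
  by case: b; [exact: measurable_funrpos | exact: measurable_funrneg].
have g0 i b x : 0 <= g i b x by case: b; [exact: funrpos_ge0 | exact: funrneg_ge0].
have sg i b : summable_rv (g i b \o X i).
  case: b.
    have -> : g i true \o X i = (f i \o X i)^\+ by [].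
    exact: (integrable_funrpos measurableT (sf i)).
  have -> : g i false \o X i = (f i \o X i)^\- by [].
  exact: (integrable_funrneg measurableT (sf i)).
have fE i x : f i x = \sum_b e b * g i b x.
  rewrite big_bool /= mul1r mulN1r /g.
  by have := funrposBneg (f i); move/(congr1 (@^~ x)) => /=.
have prodE w : \prod_i f i (X i w) =
    \sum_(h : {ffun I -> bool}) (\prod_i e (h i)) * \prod_i g i (h i) (X i w).
  under eq_bigr do rewrite fE.
  by rewrite bigA_distr_bigA; apply: eq_bigr => h _; rewrite big_split.
have H (h : {ffun I -> bool}) :=
  ge0_expectation_prod (fun i => mg i (h i)) (fun i => g0 i (h i)) (fun i => sg i (h i)).
under eq_fun do rewrite prodE.
split; first by apply: summable_sum => h; apply: summableZ; exact: (H h).1.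
rewrite Ex_sum; last by move=> h; apply: summableZ; exact: (H h).1.
transitivity (\sum_(h : {ffun I -> bool}) \prod_i (e (h i) * Ex (g i (h i) \o X i))).
  apply: eq_bigr => h _; rewrite big_split /= -(H h).2; apply: ExZ; exact: (H h).1.
rewrite -(bigA_distr_bigA (fun i b => e b * Ex (g i b \o X i))) /=.
apply: eq_bigr => i _.
have -> : f i \o X i = fun w => \sum_(b : bool) e b * (g i b \o X i) w.
  by apply/funext => w /=; rewrite fE.
rewrite Ex_sum; last by move=> b; exact: summableZ.
by apply: eq_bigr => b _; rewrite ExZ.
Qed.

End IndependentProducts.

Definition csummable (f : Omega -> C) :=
  summable_rv (fun w => complex.Re (f w)) /\ summable_rv (fun w => complex.Im (f w)).
Definition Ec (f : Omega -> C) : C :=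
  Ex (fun w => complex.Re (f w)) +i* Ex (fun w => complex.Im (f w)).

Lemma csummableD f g : csummable f -> csummable g -> csummable (fun w => f w + g w).
Proof.
move=> [f1 f2] [g1 g2]; split.
  by under eq_fun do rewrite raddfD; exact: summableD.
by under eq_fun do rewrite raddfD; exact: summableD.
Qed.

Lemma EcD f g : csummable f -> csummable g -> Ec (fun w => f w + g w) = Ec f + Ec g.
Proof.
move=> [f1 f2] [g1 g2]; apply/eqP; rewrite eq_complex /Ec /=; apply/andP; split; apply/eqP.
  by under eq_fun do rewrite raddfD; rewrite ExD.
by under eq_fun do rewrite raddfD; rewrite ExD.
Qed.

Lemma csummableZ_real (c : C) g : summable_rv g -> csummable (fun w => c * (g w)%:C).
Proof.
case: c => a b sg; split.
  by under eq_fun do rewrite /= mulr0 subr0; exact: summableZ.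
by under eq_fun do rewrite /= mulr0 add0r; exact: summableZ.
Qed.

Lemma EcZ_real (c : C) g : summable_rv g -> Ec (fun w => c * (g w)%:C) = c * (Ex g)%:C.
Proof.
case: c => a b sg; rewrite /Ec /=.
under eq_fun do rewrite mulr0 subr0.
under [X in _ +i* Ex X]eq_fun do rewrite mulr0 add0r.
by rewrite !ExZ //; apply/eqP; rewrite eq_complex /= !mulr0 subr0 add0r !eqxx.
Qed.

Lemma csummable0 : csummable (fun=> 0).
Proof. by split; exact: summable_cst. Qed.

Lemma csummable_sum (K : Type) (s : seq K) (Q : pred K) (g : K -> Omega -> C) :
  (forall k, Q k -> csummable (g k)) -> csummable (fun w => \sum_(k <- s | Q k) g k w).
Proof.
move=> sg; elim: s => [|k s IH]; first by under eq_fun do rewrite big_nil; exact: csummable0.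
case Qk : (Q k); under eq_fun do rewrite big_cons Qk; last by [].
by apply: csummableD => //; exact: sg.
Qed.

Lemma Ec_sum (K : Type) (s : seq K) (Q : pred K) (g : K -> Omega -> C) :
  (forall k, Q k -> csummable (g k)) ->
  Ec (fun w => \sum_(k <- s | Q k) g k w) = \sum_(k <- s | Q k) Ec (g k).
Proof.
move=> sg; elim: s => [|k s IH].
  by under eq_fun do rewrite big_nil; rewrite big_nil /Ec /= !Ex_cst.
rewrite big_cons; case Qk : (Q k); under eq_fun do rewrite big_cons Qk; last by [].
by rewrite EcD ?IH //; [exact: sg | exact: csummable_sum].
Qed.

Lemma csummableZ (c : C) f : csummable f -> csummable (fun w => c * f w).
Proof.
move=> [f1 f2].
have -> : (fun w => c * f w) = (fun w => c * (complex.Re (f w))%:C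
    + (c * 'i) * (complex.Im (f w))%:C).
  by apply/funext => w; rewrite -mulrA -mulrDr -complexE.
by apply: csummableD; exact: csummableZ_real.
Qed.

Lemma EcZ (c : C) f : csummable f -> Ec (fun w => c * f w) = c * Ec f.
Proof.
move=> [f1 f2].
have -> : (fun w => c * f w) = (fun w => c * (complex.Re (f w))%:C
    + (c * 'i) * (complex.Im (f w))%:C).
  by apply/funext => w; rewrite -mulrA -mulrDr -complexE.
rewrite EcD ?EcZ_real //; try exact: csummableZ_real.
by rewrite -mulrA -mulrDr; congr (_ * _); rewrite [RHS]complexE.
Qed.

End Expectation.

(** * Polynomials in independent variables *)

Section IndependentPolynomials.
Context {R : realType} {d : measure_display} {Omega : measurableType d}.
Variables (P : probability Omega R) (I : finType) (X : I -> Omega -> R).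
Local Notation C := R[i].
Hypothesis mX : forall i, measurable_fun setT (X i).
Hypothesis indX : mutually_independent P X.
Hypothesis momX : forall i n, summable_rv P (fun w => X i w ^+ n).

Definition monom (m : {ffun I -> nat}) (w : Omega) : R := \prod_i X i w ^+ m i.

Definition monom_mean (m : {ffun I -> nat}) : R :=
  \prod_i Ex P (fun w => X i w ^+ m i).

Definition addexp (m1 m2 : {ffun I -> nat}) : {ffun I -> nat} :=
  [ffun i => (m1 i + m2 i)%N].

Lemma expectation_monom m :
  summable_rv P (monom m) /\ Ex P (monom m) = monom_mean m.
Proof.
apply: (@expectation_prod _ _ _ P I X mX indX (fun i x => x ^+ m i)).
  by move=> i; apply: measurable_funX.
by move=> i; exact: momX.
Qed.

Lemma monomD m1 m2 w : monom (addexp m1 m2) w = monom m1 w * monom m2 w.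
Proof. by rewrite -big_split; apply: eq_bigr => i _; rewrite ffunE exprD. Qed.

(** With disjoint supports, at each [i] one of the two exponents is 0, and the moment of order 0 is
    1. *)
Lemma monom_meanD (J1 J2 : pred I) (m1 m2 : {ffun I -> nat}) :
  (forall i, J1 i -> ~~ J2 i) ->
  (forall i, ~~ J1 i -> m1 i = 0%N) -> (forall i, ~~ J2 i -> m2 i = 0%N) ->
  monom_mean (addexp m1 m2) = monom_mean m1 * monom_mean m2.
Proof.
move=> J12 H1 H2; rewrite -big_split; apply: eq_bigr => i _ /=.
rewrite ffunE; have E0 : Ex P (fun w => X i w ^+ 0) = 1 by exact: Ex_cst.
case: (boolP (J1 i)) => [/J12/H2 ->|/H1 ->].
  by rewrite addn0 E0 mulr1.
by rewrite add0n E0 mul1r.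
Qed.

(** Complex polynomials in the variables [X i] with [i] in [J], as lists of coefficients and
    exponents. For them, independence of disjoint blocks reduces to multiplicativity on
    monomials. *)
Definition polyon (J : pred I) (f : Omega -> C) : Prop :=
  exists2 s : seq (C * {ffun I -> nat}),
    (forall p, p \in s -> forall i, ~~ J i -> p.2 i = 0%N) &
    f = fun w => \sum_(p <- s) p.1 * (monom p.2 w)%:C.

Lemma expectation_poly (s : seq (C * {ffun I -> nat})) :
  csummable P (fun w => \sum_(p <- s) p.1 * (monom p.2 w)%:C) /\
  Ec P (fun w => \sum_(p <- s) p.1 * (monom p.2 w)%:C) =
  \sum_(p <- s) p.1 * (monom_mean p.2)%:C.
Proof.
have S (p : C * {ffun I -> nat}) : csummable P (fun w => p.1 * (monom p.2 w)%:C).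
  by apply: csummableZ_real; exact: (expectation_monom p.2).1.
split; first by apply: csummable_sum => p _; exact: S.
rewrite Ec_sum => [|p _]; last exact: S.
apply: eq_bigr => p _; rewrite EcZ_real ?(expectation_monom p.2).2 //.
exact: (expectation_monom p.2).1.
Qed.

Lemma polyon_csummable J f : polyon J f -> csummable P f.
Proof. by move=> [s _ ->]; exact: (expectation_poly s).1. Qed.

Lemma polyonS (J1 J2 : pred I) f : (forall i, J1 i -> J2 i) -> polyon J1 f -> polyon J2 f.
Proof.
move=> J12 [s H ->]; exists s => // p ps i J2i; apply: H => //.
by apply: contraNN J2i; exact: J12.
Qed.

Lemma polyon_cst J (c : C) : polyon J (fun=> c).
Proof.
exists [:: (c, [ffun=> 0%N])] => [p|].
  by rewrite inE => /eqP -> i _; rewrite ffunE.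
apply/funext => w; rewrite big_seq1 /monom big1 ?mulr1 // => i _.
by rewrite ffunE.
Qed.

Lemma polyon_var (J : pred I) i : J i -> polyon J (fun w => (X i w)%:C).
Proof.
move=> Ji; exists [:: (1, [ffun j => (j == i) : nat])] => [p|].
  rewrite inE => /eqP -> j Jj /=; rewrite ffunE; case: eqP => // ji.
  by rewrite ji Ji in Jj.
apply/funext => w; rewrite big_seq1 mul1r /monom (bigD1 i) //= ffunE eqxx expr1.
by rewrite big1 ?mulr1 // => j /negPf ji; rewrite ffunE ji.
Qed.

Lemma polyonD J f g : polyon J f -> polyon J g -> polyon J (fun w => f w + g w).
Proof.
move=> [s Hs ->] [t Ht ->]; exists (s ++ t).
  by move=> p; rewrite mem_cat => /orP[/Hs|/Ht].
by apply/funext => w; rewrite big_cat.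
Qed.

Definition mulpoly (s t : seq (C * {ffun I -> nat})) :=
  [seq (p.1 * q.1, addexp p.2 q.2) | p <- s, q <- t].

Lemma mulpolyE s t w :
  \sum_(p <- mulpoly s t) p.1 * (monom p.2 w)%:C =
  (\sum_(p <- s) p.1 * (monom p.2 w)%:C) * \sum_(q <- t) q.1 * (monom q.2 w)%:C.
Proof.
rewrite big_allpairs_dep big_distrl; apply: eq_bigr => p _ /=.
rewrite big_distrr; apply: eq_bigr => q _ /=.
by rewrite monomD rmorphM mulrACA.
Qed.

Lemma mulpoly_supp (J : pred I) (s t : seq (C * {ffun I -> nat})) :
  (forall p, p \in s -> forall i, ~~ J i -> p.2 i = 0%N) ->
  (forall p, p \in t -> forall i, ~~ J i -> p.2 i = 0%N) ->
  forall p, p \in mulpoly s t -> forall i, ~~ J i -> p.2 i = 0%N.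
Proof.
move=> Hs Ht _ /allpairsP[[p q] /= [ps qt ->]] i Ji /=.
by rewrite ffunE (Hs _ ps) // (Ht _ qt).
Qed.

Lemma polyonM J f g : polyon J f -> polyon J g -> polyon J (fun w => f w * g w).
Proof.
move=> [s Hs ->] [t Ht ->]; exists (mulpoly s t); first exact: mulpoly_supp.
by apply/funext => w; rewrite mulpolyE.
Qed.

Lemma polyon_sum J (K : Type) (s : seq K) (F : K -> Omega -> C) :
  (forall k, polyon J (F k)) -> polyon J (fun w => \sum_(k <- s) F k w).
Proof.
move=> H; elim: s => [|k s IH]; first by under eq_fun do rewrite big_nil; exact: polyon_cst.
by under eq_fun do rewrite big_cons; exact: polyonD.
Qed.

Lemma polyon_conj J f : polyon J f -> polyon J (fun w => conjc (f w)).
Proof.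
move=> [s Hs ->]; exists [seq (conjc p.1, p.2) | p <- s].
  by move=> _ /mapP[p ps ->]; exact: (Hs p ps).
apply/funext => w; rewrite big_map rmorph_sum; apply: eq_bigr => p _.
by rewrite rmorphM; congr (_ * _); exact: conjc_real.
Qed.

Lemma Ec_polyM_indep (J1 J2 : pred I) f g : (forall i, J1 i -> ~~ J2 i) ->
  polyon J1 f -> polyon J2 g -> Ec P (fun w => f w * g w) = Ec P f * Ec P g.
Proof.
move=> J12 [s Hs ->] [t Ht ->].
under eq_fun do rewrite -mulpolyE.
rewrite !(expectation_poly _).2 big_allpairs_dep big_distrl /=.
rewrite [LHS]big_seq [RHS]big_seq; apply: eq_bigr => p ps.
rewrite big_distrr /= [LHS]big_seq [RHS]big_seq; apply: eq_bigr => q qt.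
by rewrite (monom_meanD J12 (Hs p ps) (Ht q qt)) rmorphM mulrACA.
Qed.

(** The map [r] sends a variable to its block. As [f] is injective, the factors use disjoint blocks
    and can be split off one by one. *)
Lemma expectation_prod_blocks (K : finType) (r : I -> K) n (f : 'I_n -> K)
    (F : 'I_n -> Omega -> C) :
  injective f -> (forall k, polyon (fun i => r i == f k) (F k)) ->
  csummable P (fun w => \prod_k F k w) /\
  Ec P (fun w => \prod_k F k w) = \prod_k Ec P (F k).
Proof.
move=> fI HF.
suff H (s : seq 'I_n) : uniq s ->
    polyon (fun i => r i \in map f s) (fun w => \prod_(k <- s) F k w) /\
    Ec P (fun w => \prod_(k <- s) F k w) = \prod_(k <- s) Ec P (F k).
  have [H1 H2] := H _ (index_enum_uniq _); split => //; exact: polyon_csummable H1.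
elim: s => [_|k s IH /= /andP[ks us]].
  have -> : (fun w => \prod_(k <- [::]) F k w) = fun=> 1.
    by apply/funext => w; rewrite big_nil.
  by split; [exact: polyon_cst | rewrite big_nil /Ec /= !Ex_cst].
have [IH1 IH2] := IH us.
have -> : (fun w => \prod_(j <- k :: s) F j w) = fun w => F k w * \prod_(j <- s) F j w.
  by apply/funext => w; rewrite big_cons.
split.
  apply: polyonM.
    by apply: polyonS (HF k) => i /eqP ->; rewrite inE eqxx.
  by apply: polyonS IH1 => i H; rewrite inE H orbT.
rewrite big_cons -IH2; apply: Ec_polyM_indep (HF k) IH1 => i /eqP ->.
by rewrite mem_map.
Qed.

End IndependentPolynomials.

(** * Moments of the Gaussian law *)

Section NormalMoments.
Context {R : realType} {d : measure_display} {Omega : measurableType d}.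
Variables (P : probability Omega R) (Y : Omega -> R).
Hypothesis mY : measurable_fun setT Y.
Let sigma : R := Num.sqrt (2^-1).
Hypothesis lawY : forall A : set R, measurable A ->
  P (Y @^-1` A) = normal_prob 0 sigma A.

Let sigma_gt0 : 0 < sigma. Proof. by rewrite sqrtr_gt0 invr_gt0. Qed.
Let sigma_neq0 : sigma != 0. Proof. by rewrite gt_eqF. Qed.
Let sigma2 : sigma ^+ 2 = 2^-1. Proof. by rewrite sqr_sqrtr // invr_ge0. Qed.

(** The hypothesis on the law is the case of indicators; the transfer lemma extends it, with the
    identity as second variable and the density as weight. *)
Lemma integral_normal_law (f : R -> R) :
  measurable_fun setT f -> (forall x, 0 <= f x) ->
  (\int[P]_w (f (Y w))%:E =
   \int[@lebesgue_measure R]_x (f x * normal_pdf 0 sigma x)%:E)%E.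
Proof.
move=> mf f0.
transitivity (\int[P]_w (f (Y w) * cst 1 w)%:E)%E.
  by apply: eq_integral => w _; rewrite mulr1.
apply: (ge0_integral_transfer (X2 := id)) => //.
- exact: measurable_normal_pdf.
- exact: normal_pdf_ge0.
move=> A mA; transitivity (P (Y @^-1` A)); last by rewrite lawY.
have := integral_cst P (measurable_preimageX (fun _ : 'I_1 => mY) ord0 mA) 1%:E.
by rewrite mul1e.
Qed.

(** If [f] turns the density into [k] times another Gaussian density, the total mass 1 of the latter
    gives the mean. The exponential means below come from this, and the moments from them. *)
Lemma mean_reweight (f : R -> R) (k m s : R) : s != 0 -> 0 <= k ->
  measurable_fun setT f -> (forall x, 0 <= f x) ->
  (forall x, f x * normal_pdf 0 sigma x = k * normal_pdf m s x) ->
  summable_rv P (f \o Y) /\ Ex P (f \o Y) = k.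
Proof.
move=> s0 k0 mf f0 fE.
have e : (\int[P]_w (f (Y w))%:E = k%:E)%E.
  rewrite integral_normal_law //; under eq_integral do rewrite fE EFinM.
  rewrite ge0_integralZl_EFin //.
  - by rewrite integral_normal_pdf mule1.
  - by move=> x _; rewrite lee_fin normal_pdf_ge0.
  - by apply/measurable_EFinP; exact: measurable_normal_pdf.
split; last by rewrite /Ex /Rintegral /= e.
apply/integrableP; split.
  by apply/measurable_EFinP; exact: (measurableT_comp mf mY).
under eq_integral do rewrite /= ger0_norm //.
by rewrite e ltry.
Qed.

(** The weight turns the exponent [- x ^+ 2] of the density into [- (t * x) ^+ 2]: the standard
    deviation is divided by [t], the peak multiplied by [t]. *)
Lemma mean_expR_sqr (t : R) : 0 < t ->
  summable_rv P (fun w => expR ((1 - t ^+ 2) * Y w ^+ 2)) /\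
  Ex P (fun w => expR ((1 - t ^+ 2) * Y w ^+ 2)) = t^-1.
Proof.
move=> t0.
apply: (@mean_reweight (fun x => expR ((1 - t ^+ 2) * x ^+ 2)) t^-1 0 (sigma / t)).
- by rewrite mulf_neq0 // invr_eq0 gt_eqF.
- by rewrite invr_ge0 ltW.
- by apply: measurableT_comp => //; apply: measurable_funM.
- by move=> x; exact: expR_ge0.
move=> x; rewrite !normal_pdfE ?mulf_neq0 ?invr_eq0 ?gt_eqF //.
have -> : normal_peak (sigma / t) = t * normal_peak sigma.
  rewrite /normal_peak.
  have -> : (sigma / t) ^+ 2 * pi *+ 2 = t^-1 ^+ 2 * (sigma ^+ 2 * pi *+ 2).
    have gen (a b p : R) : (a * b) ^+ 2 * p *+ 2 = b ^+ 2 * (a ^+ 2 * p *+ 2) by ring.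
    exact: gen.
  by rewrite sqrtrM ?sqr_ge0 // sqrtr_sqr ger0_norm ?invr_ge0 1?ltW // invfM invrK.
transitivity (normal_peak sigma * normal_fun 0 (sigma / t) x); last first.
  by rewrite !mulrA mulVf ?gt_eqF // mul1r.
rewrite mulrCA; congr (_ * _).
rewrite -expRD; congr expR.
rewrite expr_div_n sigma2.
by field; rewrite gt_eqF.
Qed.

(* The tilted density is the Gaussian density of mean [c / 2]. *)
Lemma mean_expR_lin (c : R) :
  summable_rv P (fun w => expR (c * Y w - c ^+ 2 / 4)) /\
  Ex P (fun w => expR (c * Y w - c ^+ 2 / 4)) = 1.
Proof.
apply: (@mean_reweight (fun x => expR (c * x - c ^+ 2 / 4)) 1 (c / 2) sigma) => //.
  by apply: measurableT_comp => //; exact: measurable_funB.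
move=> x; rewrite !normal_pdfE // mul1r mulrCA; congr (_ * _).
rewrite -expRD; congr expR.
by rewrite sigma2; field.
Qed.

Lemma summable_normalX n : summable_rv P (fun w => Y w ^+ n).
Proof.
case: n => [|n]; first exact: summable_cst.
(* With [y = x ^+ 2 / (2 * n.+1)], the bound [y <= expR y] raised to the power [n.+1] gives
   [x ^+ (2 * n.+1) <= K * expR (x ^+ 2 / 2)]; the right side is integrable by [mean_expR_sqr] at
   [t ^+ 2 = 1 / 2]. *)
pose K : R := (2 * n.+1)%:R ^+ n.+1.
have t0 : 0 < Num.sqrt (2^-1 : R) by rewrite sqrtr_gt0 invr_gt0.
have [S _] := mean_expR_sqr t0.
have := summableD (summable_cst P 1) (summableZ K S); apply: le_integrable => //.
  by apply/measurable_EFinP; exact: measurable_funX.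
move=> w _; rewrite /= lee_fin [X in _ <= X]ger0_norm; last first.
  by rewrite addr_ge0 // mulr_ge0 ?expR_ge0 // exprn_ge0.
set x := Y w.
have h1 : `|x ^+ n.+1| <= 1 + x ^+ n.+1 ^+ 2.
  rewrite -[x ^+ n.+1 ^+ 2]real_normK ?num_real //.
  by set z := `|_|; nra.
apply: (le_trans h1); rewrite lerD2l -exprM mulnC exprM.
have n0 : 0 < (2 * n.+1)%:R :> R by rewrite ltr0n.
have -> : x ^+ 2 = (2 * n.+1)%:R * (x ^+ 2 / (2 * n.+1)%:R) by rewrite mulrCA divff ?mulr1 // gt_eqF.
rewrite exprMn ler_wpM2l ?exprn_ge0 //.
have -> : (1 - Num.sqrt (2^-1 : R) ^+ 2) * ((2 * n.+1)%:R * (x ^+ 2 / (2 * n.+1)%:R)) =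
    n.+1%:R * (x ^+ 2 / (2 * n.+1)%:R).
  rewrite sqr_sqrtr ?invr_ge0 // natrM; field.
  by rewrite addrC natr1 pnatr_eq0.
rewrite expRM_natl; apply: lerXn2r; rewrite ?nnegrE ?expR_ge0 ?divr_ge0 ?sqr_ge0 //.
by apply: le_trans (expR_ge1Dx _); rewrite lerDr.
Qed.

(* [1 + y <= expR y] bounds [c * Ex P Y] by [c ^+ 2 / 4] for every [c]. *)
Lemma normal_mean1 : Ex P Y = 0.
Proof.
have SY : summable_rv P Y by have := summable_normalX 1.
have H c : c * Ex P Y <= c ^+ 2 / 4.
  have [S E] := mean_expR_lin c.
  have : Ex P (fun w => 1 + - (c ^+ 2 / 4) + c * Y w) <= 1.
    rewrite -[X in _ <= X]E; apply: le_Rintegral => //.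
      by apply: summableD; [exact: summable_cst | exact: summableZ].
    move=> w _; apply: le_trans (expR_ge1Dx _); lra.
  rewrite ExD ?Ex_cst ?ExZ //; [lra | exact: summable_cst | exact: summableZ].
(* At [c = M] the bound reads [M ^+ 2 <= M ^+ 2 / 4], which forces [M = 0]. *)
have := H (Ex P Y); have := H (- Ex P Y).
set M := Ex P Y => h1 h2; apply/eqP; rewrite -sqrf_eq0 eq_le sqr_ge0 andbT.
nra.
Qed.

(* [1 + y <= expR y] bounds the second moment by [(t * (1 + t))^-1], from above
   for [t < 1] and from below for [1 < t]. *)
Lemma normal_mean2 : Ex P (fun w => Y w ^+ 2) = 2^-1.
Proof.
have SY := summable_normalX 2.
set M := Ex _ _.
have M0 : 0 <= M by apply: Rintegral_ge0 => w _; rewrite sqr_ge0.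
have H t : 0 < t -> 1 + (1 - t ^+ 2) * M <= t^-1.
  move=> t0; have [S <-] := mean_expR_sqr t0.
  rewrite -[X in X + _](Ex_cst P) -ExZ // -ExD //; last 2 first.
  - exact: summable_cst.
  - exact: summableZ.
  apply: le_Rintegral => //.
    by apply: summableD; [exact: summable_cst | exact: summableZ].
  by move=> w _; exact: expR_ge1Dx.
have H' t : 0 < t -> t + t * (1 - t ^+ 2) * M <= 1.
  by move=> t0; have := H t t0; rewrite -(ler_pM2l t0) mulfV ?gt_eqF // mulrDr mulr1 mulrA.
apply/eqP; rewrite eq_le; apply/andP; split; rewrite leNgt; apply/negP => lt.
- have M1 : 0 < M by apply: lt_trans lt; rewrite invr_gt0.
  (* Chosen so that [3 * e * M = M - 1 / 2]; then [(1 - e) * (2 - e) * M] is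
     [M + 1 / 2 + e ^+ 2 * M], which exceeds 1. *)
  pose e := (2 * M - 1) / (6 * M).
  have eE : 6 * M * e = 2 * M - 1 by rewrite /e; field; rewrite gt_eqF.
  have e0 : 0 < e by nra.
  have e1 : e < 1 by nra.
  have := H' (1 - e); rewrite subr_gt0 => /(_ e1) h.
  have {}h : (1 - e) * (2 - e) * M <= 1 by nra.
  nra.
(* Here [M = 1 / 2 - 2 * e], and [(1 + e) * (2 + e) * M] falls below 1. *)
- pose e := (1 - 2 * M) / 4.
  have eE : 4 * e = 1 - 2 * M by rewrite /e; field.
  have e0 : 0 < e by lra.
  have e1 : e <= 4^-1 by lra.
  have := H' (1 + e); rewrite addr_gt0 // => /(_ isT) h.
  have {}h : 1 <= (1 + e) * (2 + e) * M by nra.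
  nra.
Qed.

End NormalMoments.

(** * Gram determinants *)

Section GramPositivity.
Variable R : realType.
Local Notation C := R[i].

Lemma conjc_mul_ge0 (z : C) : 0 <= conjc z * z.
Proof.
case: z => a b; rewrite lecE /=; apply/andP; split; first by apply/eqP; ring.
by rewrite mulNr opprK addr_ge0 // -expr2 sqr_ge0.
Qed.

(** The symmetrized expansion writes [t!] times the determinant as a sum of squared moduli of
    minors, as in the Cauchy-Binet formula. *)
Lemma det_gram_ge0 n t (A : 'M[C]_(n, t)) : 0 <= \det (ctr A *m A).
Proof.
have tp : 0 < (t`!)%:R :> C by rewrite ltr0n fact_gt0.
rewrite -(pmulr_rge0 _ tp) det_mulmx_sym; apply: sumr_ge0 => f _.
have -> : \matrix_(i, j) (ctr A) i (f j) = map_mx conjc (\matrix_(i, j) A (f i) j)^T.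
  by apply/matrixP => i j; rewrite !mxE.
by rewrite det_map_mx det_tr; exact: conjc_mul_ge0.
Qed.

Definition colpick n t (Q : {set 'I_t}) (A : 'M[C]_(n, t)) : 'M[C]_(n, #|Q|) :=
  \matrix_(i, j) A i (enum_val j).

Lemma colpickE n t (Q : {set 'I_t}) (A : 'M[C]_(n, t)) i j :
  colpick Q A i j = A i (enum_val j).
Proof. by rewrite mxE. Qed.

Lemma psubE t (Q : {set 'I_t}) (A : 'M[C]_t) i j :
  psub Q A i j = A (enum_val i) (enum_val j).
Proof. by rewrite mxE. Qed.

Lemma psub_gram n t (Q : {set 'I_t}) (A : 'M[C]_(n, t)) :
  psub Q (ctr A *m A) = ctr (colpick Q A) *m colpick Q A.
Proof.
apply/matrixP => i j; rewrite !mxE; apply: eq_bigr => k _.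
by rewrite !mxE.
Qed.

Lemma psub_principal t (Q : {set 'I_t}) (A : 'M[C]_t) : psub Q A = principal Q A.
Proof. by apply/matrixP => i j; rewrite !mxE. Qed.

Lemma det_1Dgram n t (c : R) (A : 'M[C]_(n, t)) :
  \det (1%:M + c%:C *: (ctr A *m A)) =
  \sum_(Q : {set 'I_t}) c%:C ^+ #|Q| * \det (psub Q (ctr A *m A)).
Proof. by rewrite det_1Dscale; under eq_bigr do rewrite -psub_principal. Qed.

(** The empty set contributes 1 and every other principal minor is a Gram determinant. In the order
    of [C] the inequality also says that the determinant is real. *)
Lemma det_1Dgram_ge1 n t (c : R) (A : 'M[C]_(n, t)) : 0 <= c ->
  1 <= \det (1%:M + c%:C *: (ctr A *m A)).
Proof.
move=> c0; rewrite det_1Dgram (bigD1 finset.set0) //=.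
rewrite psub_principal det_principal cards0 expr0 mul1r.
have -> : mixmx finset.set0 (ctr A *m A) 1%:M = 1%:M.
  by apply/matrixP => i j; rewrite !mxE inE.
rewrite det1 lerDl; apply: sumr_ge0 => Q _.
by rewrite psub_gram mulr_ge0 ?det_gram_ge0 // exprn_ge0 // lecR.
Qed.

End GramPositivity.

(** * From nonzero eigenvalues to the function J *)

Section NonzeroEigenvalues.
Variable R : realType.
Local Notation C := R[i].

(** Since [n - size s] is a truncated subtraction, the bound is obtained by comparing degrees. *)
Lemma size_nonzero_eigs n (A : 'M[C]_n) (s : seq R) :
  nonzero_eigs A s -> (size s <= n)%N.
Proof.
move=> [_ e]; have := congr1 (fun p : {poly C} => size p) e.
rewrite size_char_poly size_monicM ?monicXn ?monic_neq0 ?monic_prod_XsubC //.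
rewrite size_polyXn size_prod_XsubC /= addnS /= => -[->].
by rewrite leq_addl.
Qed.

Lemma coef_prod_1DscaleX_real (s : seq R) k :
  (\prod_(a <- map (fun a => a%:C) s) (1 + a *: 'X))`_k =
  ((\prod_(a <- s) (1 + a *: 'X))`_k)%:C :> C.
Proof.
rewrite big_map -coef_map rmorph_prod; congr (nth 0 (polyseq _) k).
by apply: eq_bigr => a _; rewrite rmorphD rmorph1 /= linearZ /= map_polyX.
Qed.

(** Both sides are sums over [k] of the elementary symmetric functions times [(n - k)!]: the weight
    on the left divides by [(n - t)!], [JfunE] divides by [(n - size s)!], and the last factor
    converts one into the other. *)
Lemma sum_mixmx_Jfun n t (Psi Sig : 'M[C]_t) (s : seq R) : (t <= n)%N ->
  Psi \in unitmx -> nonzero_eigs (invmx Psi *m Sig) s ->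
  \sum_(S : {set 'I_t}) ((n - #|S|) ^_ (t - #|S|))%:R * \det (mixmx S Sig Psi) =
  \det Psi * (Jfun n s)%:C * (((n - size s)`!)%:R / ((n - t)`!)%:R).
Proof.
move=> tn uP eigs; have st := size_nonzero_eigs eigs; have [_ ech] := eigs.
pose s' := [seq a%:C | a <- s].
rewrite (@sum_mixmx_coef _ _ Sig Psi (\det Psi *: \prod_(a <- s') (1 + a *: 'X))
  (fun k => ((n - k) ^_ (t - k))%:R)); last first.
  move=> x x0; rewrite hornerZ -(@det_1Dscale_eigs _ _ (invmx Psi *m Sig)) ?size_map //.
    by rewrite -det_mulmx mulmxDr mulmx1 -scalemxAr mulmxA mulmxV // mul1mx.
  by rewrite ech big_map.
rewrite JfunE; last exact: leq_trans st tn.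
set L := size s; set e := fun k => (\prod_(a <- s) (1 + a *: 'X))`_k.
rewrite rmorph_sum /= big_distrr big_distrl /=.
pose F k := \det Psi * ((e k * ((n - k) ^_ (L - k))%:R)%:C) *
  (((n - L)`!)%:R / ((n - t)`!)%:R) : C.
(* The coefficients of degree above [L] vanish, so both sums may run up to [t]. *)
rewrite (big_ord_widen t.+1 F) // [RHS]big_mkcond; apply: eq_bigr => k _.
rewrite coefZ coef_prod_1DscaleX_real -/(e k); case: ifPn; rewrite ltnS => kL; last first.
  by rewrite /e coef_prod_1DscaleX_gt ?ltnNge // mulr0 mulr0.
have kt : (k <= t)%N := leq_trans kL st.
have f1 : ((n - k) ^_ (L - k) * (n - L)`! = (n - k)`!)%N.
  have := @ffact_fact (n - k) (L - k) (leq_sub2r k (leq_trans st tn)).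
  by rewrite subnBA // subnK // (leq_trans kL) // (leq_trans st).
have f2 : ((n - k) ^_ (t - k) * (n - t)`! = (n - k)`!)%N.
  have := @ffact_fact (n - k) (t - k) (leq_sub2r k tn).
  by rewrite subnBA // subnK // (leq_trans kt).
have nz : ((n - t)`!)%:R != 0 :> C by rewrite pnatr_eq0 -lt0n fact_gt0.
rewrite /F rmorphM rmorph_nat; apply: (mulIf nz); rewrite !mulrA divfK //.
have : ((n - k) ^_ (t - k))%:R * ((n - t)`!)%:R = ((n - k) ^_ (L - k))%:R * ((n - L)`!)%:R :> C.
  by rewrite -!natrM f1 f2.
set u1 := _%:R; set u2 := _%:R; set u3 := _%:R; set u4 := _%:R => H.
transitivity (\det Psi * (e k)%:C * (u1 * u2)); first by ring.
by rewrite H; ring.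
Qed.

End NonzeroEigenvalues.

(** * Mean of a Gram determinant with independent rows *)

Section ExpectedGram.
Context {R : realType} {d : measure_display} {Omega : measurableType d}.
Variables (P : probability Omega R) (I : finType) (X : I -> Omega -> R).
Local Notation C := R[i].
Hypothesis mX : forall i, measurable_fun setT (X i).
Hypothesis indX : mutually_independent P X.
Hypothesis momX : forall i n, summable_rv P (fun w => X i w ^+ n).

(** For injective [f], the factors of a Leibniz term lie in distinct rows, so its mean is the
    product of second moments. Reassembling the determinant gives the sum computed by
    [sum_inj_det_rank1D]. *)
Lemma expectation_det_gram n t (r : I -> 'I_n) (A : Omega -> 'M[C]_(n, t))
    (Ab : 'M[C]_(n, t)) (Psi : 'M[C]_t) : (0 < n)%N ->
  (forall k j, polyon X (fun i => r i == k) (fun w => A w k j)) ->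
  (forall k i j, Ec P (fun w => conjc (A w k i) * A w k j) =
     conjc (Ab k i) * Ab k j + Psi i j) ->
  csummable P (fun w => \det (ctr (A w) *m A w)) /\
  Ec P (fun w => \det (ctr (A w) *m A w)) =
  \sum_(S : {set 'I_t}) ((n - #|S|) ^_ (t - #|S|))%:R *
     \det (mixmx S (ctr Ab *m Ab) Psi).
Proof.
move=> n0 pA mA.
pose F (f : {ffun 'I_t -> 'I_n}) (s : 'S_t) w :=
  \prod_i (conjc (A w (f i) i) * A w (f i) (s i)).
have detE : (fun w => \det (ctr (A w) *m A w)) =
    fun w => \sum_(f : {ffun 'I_t -> 'I_n} | injectiveb f)
      \sum_(s : 'S_t) (-1) ^+ s * F f s w.
  apply/funext => w; rewrite det_mulmx_inj; apply: eq_bigr => f _.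
  apply: eq_bigr => s _; congr (_ * _); apply: eq_bigr => i _.
  by rewrite !mxE.
have HF (f : {ffun 'I_t -> 'I_n}) s : injectiveb f ->
    csummable P (F f s) /\
    Ec P (F f s) = \prod_i (conjc (Ab (f i) i) * Ab (f i) (s i) + Psi i (s i)).
  move=> /injectiveP fI.
  have pF i : polyon X (fun v => r v == f i)
      (fun w => conjc (A w (f i) i) * A w (f i) (s i)).
    by apply: polyonM => //; apply: polyon_conj.
  have [H1 H2] := expectation_prod_blocks mX indX momX fI pF.
  split => //; rewrite /F H2; apply: eq_bigr => i _; exact: mA.
have S1 (f : {ffun 'I_t -> 'I_n}) : injectiveb f ->
    csummable P (fun w => \sum_(s : 'S_t) (-1) ^+ s * F f s w).
  by move=> fI; apply: csummable_sum => s _; apply: csummableZ; exact: (HF f s fI).1.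
rewrite detE; split; first by apply: csummable_sum.
rewrite Ec_sum // -sum_inj_det_rank1D //; apply: eq_bigr => f fI.
rewrite Ec_sum; last by move=> s _; apply: csummableZ; exact: (HF f s fI).1.
apply: eq_bigr => s _; rewrite EcZ; last exact: (HF f s fI).1.
rewrite (HF f s fI).2; congr (_ * _); apply: eq_bigr => i _.
by rewrite !mxE.
Qed.

End ExpectedGram.

(** * Second moments of the noise and of the channel *)

Section Channel.
Context {R : realType} {d : measure_display} {Omega : measurableType d}.
Variables (P : probability Omega R) (Nr M Nt : nat).
Local Notation C := R[i].
Variables (Rt : Omega -> 'M[C]_(Nr, M)) (Ht : Omega -> 'M[C]_(Nr, Nt)).
Hypothesis iid : iid_CN01 P Rt Ht.

Local Notation I := (('I_Nr * 'I_M * bool) + ('I_Nr * 'I_Nt * bool))%type.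
Local Notation X := (entries_family Rt Ht).

Let mX : forall i, measurable_fun setT (X i). Proof. by case: iid. Qed.
Let lawX : forall i (A : set R), measurable A ->
  P (X i @^-1` A) = normal_prob 0 (Num.sqrt (2^-1)) A.
Proof. by case: iid. Qed.
Let indX : mutually_independent P X. Proof. by case: iid. Qed.

Lemma entries_moments i n : summable_rv P (fun w => X i w ^+ n).
Proof. exact: summable_normalX (mX i) (lawX i) n. Qed.
Let momX := entries_moments.

(** The independent blocks: row [k] of [Rt] together with row [k] of [Ht]. *)
Definition row_of (i : I) : 'I_Nr :=
  match i with inl (k, _, _) => k | inr (k, _, _) => k end.

Local Notation U := ('I_M + 'I_Nt)%type.

Definition entry (k : 'I_Nr) (u : U) (w : Omega) : C :=
  match u with inl m => Rt w k m | inr j => Ht w k j end.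

Definition entry_index (k : 'I_Nr) (u : U) (b : bool) : I :=
  match u with inl m => inl (k, m, b) | inr j => inr (k, j, b) end.

Lemma entryE k u w : entry k u w =
  (X (entry_index k u true) w)%:C + 'i * (X (entry_index k u false) w)%:C.
Proof. by case: u => ? /=; rewrite [LHS]complexE. Qed.

Definition in_entry (k : 'I_Nr) (u : U) : pred I :=
  fun i => (i == entry_index k u true) || (i == entry_index k u false).

Lemma polyon_entry k u : polyon X (in_entry k u) (entry k u).
Proof.
have -> : entry k u = fun w => (X (entry_index k u true) w)%:C +
    'i * (X (entry_index k u false) w)%:C by apply/funext => w; exact: entryE.
apply: polyonD; first by apply: polyon_var; rewrite /in_entry eqxx.
by apply: polyonM; [exact: polyon_cst | apply: polyon_var; rewrite /in_entry eqxx orbT].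
Qed.

Lemma polyon_entry_row k u : polyon X (fun i => row_of i == k) (entry k u).
Proof.
apply: polyonS (polyon_entry k u) => i.
by case: u => ? /orP[] /eqP -> /=.
Qed.

Lemma in_entry_disjoint k u v : u != v -> forall i, in_entry k u i -> ~~ in_entry k v i.
Proof.
move=> uv i; rewrite /in_entry negb_or; case: u v uv => [u|u] [v|v] uv /orP[] /eqP ->;
  apply/andP; split => //; apply: contra uv => /eqP [] //.
- by move=> ->.
- by move=> ->.
- by move=> ->.
- by move=> ->.
Qed.

Lemma Ec_entry k u : Ec P (entry k u) = 0.
Proof.
rewrite /Ec.
have h b : Ex P (X (entry_index k u b)) = 0.
  exact: normal_mean1 (mX _) (lawX _).
by case: u h => ? h; have := h true; have := h false; rewrite /entry /= => -> ->.
Qed.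

Lemma Ec_conj f : csummable P f -> Ec P (fun w => conjc (f w)) = conjc (Ec P f).
Proof.
move=> [f1 f2]; rewrite /Ec /=.
have -> : (fun w => complex.Re (conjc (f w))) = fun w => complex.Re (f w).
  by apply/funext => w; case: (f w).
have -> : (fun w => complex.Im (conjc (f w))) = fun w => -1 * complex.Im (f w).
  by apply/funext => w; case: (f w) => a b; rewrite mulN1r.
by rewrite ExZ // mulN1r.
Qed.

(** Distinct entries are independent and centred; for equal ones the real and imaginary parts
    contribute 1/2 each. *)
Lemma Ec_entry2 k u v :
  Ec P (fun w => conjc (entry k u w) * entry k v w) = (u == v)%:R.
Proof.
have [<-|uv] := eqVneq u v; last first.
  rewrite (Ec_polyM_indep mX indX momX (@in_entry_disjoint k u v uv) (polyon_conj (polyon_entry k u))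
    (polyon_entry k v)).
  by rewrite Ec_entry mulr0.
have -> : (fun w => conjc (entry k u w) * entry k u w) =
    fun w => 1 * (X (entry_index k u true) w ^+ 2 + X (entry_index k u false) w ^+ 2)%:C.
  apply/funext => w; rewrite mul1r.
  have -> : X (entry_index k u true) w = complex.Re (entry k u w) by case: u.
  have -> : X (entry_index k u false) w = complex.Im (entry k u w) by case: u.
  case: (entry k u w) => a b; apply/eqP; rewrite eq_complex /=.
  by apply/andP; split; apply/eqP; ring.
have S b := momX (entry_index k u b) 2.
rewrite EcZ_real; last exact: summableD.
rewrite mul1r ExD //.
rewrite !(normal_mean2 (mX _) (lawX _)).
by rewrite -[1%:R]/(1%:C); congr (_%:C); field.
Qed.

Variables (c : U -> 'I_Nt -> C) (Ab : 'M[C]_(Nr, Nt)) (A : Omega -> 'M[C]_(Nr, Nt)).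
Hypothesis AE : forall w k j, A w k j = Ab k j + \sum_u c u j * entry k u w.

Lemma polyon_channel k j : polyon X (fun i => row_of i == k) (fun w => A w k j).
Proof.
have -> : (fun w => A w k j) = fun w => Ab k j + \sum_u c u j * entry k u w.
  by apply/funext => w; exact: AE.
apply: polyonD; first exact: polyon_cst.
apply: polyon_sum => u; apply: polyonM; [exact: polyon_cst | exact: polyon_entry_row].
Qed.

(** The cross terms vanish because the noise is centred, and orthonormality of the entries keeps
    only the diagonal of the double sum. As [c] is the same for all rows, so is the covariance. *)
Lemma channel_covariance k i j :
  Ec P (fun w => conjc (A w k i) * A w k j) =
  conjc (Ab k i) * Ab k j + \sum_u conjc (c u i) * c u j.
Proof.
have Se u : csummable P (entry k u).
  exact: (polyon_csummable mX indX momX (polyon_entry k u)).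
have Sc u : csummable P (fun w => conjc (entry k u w)).
  exact: (polyon_csummable mX indX momX (polyon_conj (polyon_entry k u))).
have S2 u v : csummable P (fun w => conjc (entry k u w) * entry k v w).
  apply: (polyon_csummable mX indX momX); apply: polyonM (polyon_entry_row k v).
  exact: polyon_conj (polyon_entry_row k u).
have SW : csummable P (fun w => \sum_u c u j * entry k u w).
  by apply: csummable_sum => u _; exact: csummableZ.
pose a u := conjc (c u i).
have SW' : csummable P (fun w => \sum_u a u * conjc (entry k u w)).
  by apply: csummable_sum => u _; exact: csummableZ.
have SQ : csummable P (fun w => \sum_u \sum_v (a u * c v j) * (conjc (entry k u w) * entry k v w)).
  by apply: csummable_sum => u _; apply: csummable_sum => v _; exact: csummableZ.
have S1 : csummable P (fun=> conjc (Ab k i) * Ab k j) by split; exact: summable_cst.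
have -> : (fun w => conjc (A w k i) * A w k j) =
   fun w => conjc (Ab k i) * Ab k j + (conjc (Ab k i) * (\sum_u c u j * entry k u w)
     + (Ab k j * (\sum_u a u * conjc (entry k u w))
     + \sum_u \sum_v (a u * c v j) * (conjc (entry k u w) * entry k v w))).
  apply/funext => w; rewrite !AE rmorphD rmorph_sum /=.
  have -> : \sum_u conjc (c u i * entry k u w) = \sum_u a u * conjc (entry k u w).
    by apply: eq_bigr => u _; rewrite rmorphM.
  have -> : \sum_u \sum_v (a u * c v j) * (conjc (entry k u w) * entry k v w) =
      (\sum_u a u * conjc (entry k u w)) * (\sum_u c u j * entry k u w).
    rewrite big_distrl; apply: eq_bigr => u _ /=; rewrite big_distrr.
    by apply: eq_bigr => v _ /=; rewrite mulrACA.
  by ring.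
rewrite EcD //; last by apply: csummableD; [|apply: csummableD]; try exact: csummableZ.
congr (_ + _); first by rewrite /Ec /= !Ex_cst; case: (_ * _).
rewrite EcD //; [|exact: csummableZ|by apply: csummableD => //; exact: csummableZ].
rewrite EcD //; last exact: csummableZ.
rewrite !EcZ // !Ec_sum; try by move=> u _; exact: csummableZ.
  rewrite [X in _ * X]big1 => [|u _]; last by rewrite EcZ // Ec_entry mulr0.
  rewrite [X in _ + (_ * X + _)]big1 => [|u _]; last first.
    by rewrite EcZ // Ec_conj // Ec_entry rmorph0 mulr0.
  rewrite !mulr0 !add0r; apply: eq_bigr => u _.
  rewrite Ec_sum => [|v _]; last exact: csummableZ.
  rewrite (bigD1 u) //= EcZ // Ec_entry2 eqxx mulr1 big1 ?addr0 // => v vu.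
  by rewrite EcZ // Ec_entry2 eq_sym (negPf vu) mulr0.
by move=> u _; apply: csummable_sum => v _; exact: csummableZ.
Qed.

End Channel.

(** * Jensen's inequality for the logarithm *)

Section Jensen.
Context {R : realType} {d : measure_display} {Omega : measurableType d}.
Variable P : probability Omega R.

Lemma ln_le_tangent (c x : R) : 0 < c -> 0 < x -> ln x <= ln c + (x / c - 1).
Proof.
move=> c0 x0; have xc : 0 < x / c by rewrite divr_gt0.
rewrite -lerBlDl -ln_div ?posrE //.
by have := @le_ln1Dx R (x / c - 1); rewrite [1 + _]addrC subrK; apply; rewrite ltrBrDr addNr.
Qed.

(* The tangent line of [log2] at the mean of [Z] dominates [log2]. *)
Lemma integral_log2_le (Z : Omega -> R) :
  (forall w, 1 <= Z w) -> summable_rv P Z ->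
  (\int[P]_w (log2 (Z w))%:E <= (log2 (Ex P Z))%:E)%E.
Proof.
move=> Z1 SZ; pose c := Ex P Z.
have Z0 w : 0 < Z w := lt_le_trans ltr01 (Z1 w).
have c1 : 1 <= c.
  by rewrite -[X in X <= _](Ex_cst P 1); apply: le_Rintegral => //; exact: summable_cst.
have c0 : 0 < c := lt_le_trans ltr01 c1.
have l2 : 0 < ln 2 :> R by rewrite ln_gt0 // ltr1n.
pose h w : R := ((ln c - 1) / ln 2) + (c * ln 2)^-1 * Z w.
have hE w : h w = (ln c + (Z w / c - 1)) / ln 2.
  by rewrite /h; field; rewrite !gt_eqF.
have Sh : summable_rv P h by apply: summableD; [exact: summable_cst | exact: summableZ].
have lh w : log2 (Z w) <= h w.
  by rewrite hE ler_pM2r ?invr_gt0 // ln_le_tangent.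
have mZ : measurable_fun setT Z by apply/measurable_EFinP; exact: measurable_int SZ.
(* Thanks to [1 <= Z] the integrand is nonnegative, so the integrals can be compared without first
   proving [log2 \o Z] integrable. *)
have log0 w : 0 <= log2 (Z w) by apply: divr_ge0; [exact: ln_ge0 | exact: ltW].
apply: (@le_trans _ _ (\int[P]_w (h w)%:E)%E).
  apply: ge0_le_integral => //.
  - by move=> w _; rewrite lee_fin.
  - apply/measurable_EFinP; apply: measurable_funM => //.
    by apply: measurableT_comp => //; exact: measurable_ln.
  - exact: measurable_int Sh.
  - by move=> w _; rewrite lee_fin.
rewrite ExE // lee_fin /h (ExD (summable_cst P _) (summableZ _ SZ)) Ex_cst ExZ //.
rewrite -/c /log2 le_eqVlt; apply/orP; left; apply/eqP; field.
by rewrite !gt_eqF.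
Qed.

End Jensen.

(** * The channel as an affine function of the noise *)

Section ChannelMatrices.
Variable R : realType.
Local Notation C := R[i].

Lemma csqrtM (x y : R) : 0 <= x -> csqrt (x * y) = csqrt x * csqrt y.
Proof. by move=> x0; rewrite /csqrt sqrtrM // rmorphM. Qed.

Lemma csqrt_conj_mul (x : R) : 0 <= x -> conjc (csqrt x) * csqrt x = x%:C.
Proof.
by move=> x0; rewrite /csqrt [conjc _]conjc_real -rmorphM -expr2 sqr_sqrtr.
Qed.

Lemma cexpi_conj_mul (x : R) : conjc (cexpi x) * cexpi x = 1.
Proof.
rewrite /cexpi; apply/eqP; rewrite eq_complex /=; apply/andP; split; apply/eqP.
  by rewrite mulNr opprK -!expr2 cos2Dsin2.
by ring.
Qed.

Variables (Nr Nt M : nat) (bt br bd LR NR LH NH : R).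
Variables (Rb : 'M[C]_(Nr, M)) (thphi : 'I_M -> R) (T : 'M[C]_(M, Nt)) (Hb : 'M[C]_(Nr, Nt)).
Hypotheses (bt0 : 0 <= bt) (br0 : 0 <= br) (bd0 : 0 <= bd).
Hypotheses (NR0 : 0 <= NR) (NH0 : 0 <= NH).
Let Ph := Phimat thphi.

Definition noise_coef (u : 'I_M + 'I_Nt) (j : 'I_Nt) : C :=
  match u with
  | inl m => csqrt (bt * br * NR) * (cexpi (thphi m) * T m j)
  | inr l => csqrt (bd * NH) * (l == j)%:R
  end.

Lemma GchanE d (Omega : measurableType d) (Rt : Omega -> 'M[C]_(Nr, M))
    (Ht : Omega -> 'M[C]_(Nr, Nt)) w k j :
  Gchan bt br bd LR NR LH NH Rb Ph T Hb (Rt w) (Ht w) k j =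
  Gbar bt br bd LR LH Rb Ph T Hb k j + \sum_u noise_coef u j * entry Rt Ht k u w.
Proof.
have bb : 0 <= bt * br by rewrite mulr_ge0.
have -> : \sum_u noise_coef u j * entry Rt Ht k u w =
    csqrt (bt * br * NR) * (Rt w *m Ph *m T) k j + csqrt (bd * NH) * Ht w k j.
  rewrite big_sumType /=; congr (_ + _).
    rewrite mul_mx_diag !mxE big_distrr; apply: eq_bigr => m _ /=.
    by rewrite !mxE; ring.
  rewrite (bigD1 j) //= eqxx mulr1 big1 ?addr0 // => l /negPf ->.
  by rewrite mulr0 mul0r.
rewrite /Gchan /Gbar !mulmxDl !scalerDr -!scalemxAl !scalerA -!csqrtM //.
rewrite !mxE.
by ring.
Qed.

(** The phases of [Ph] have modulus 1 and cancel, so the noise covariance depends on [T] only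
    through its Gram matrix. *)
Lemma PsimatE i j :
  Psimat bt br bd NR NH T i j = \sum_u conjc (noise_coef u i) * noise_coef u j.
Proof.
have a0 : 0 <= bt * br * NR by rewrite !mulr_ge0.
have b0 : 0 <= bd * NH by rewrite mulr_ge0.
rewrite big_sumType /= /Psimat !mxE; congr (_ + _).
  rewrite big_distrr; apply: eq_bigr => m _ /=.
  rewrite !mxE -(csqrt_conj_mul a0); set q := csqrt _.
  have cM (x y : C) : conjc (x * y) = conjc x * conjc y by rewrite rmorphM.
  rewrite !cM.
  transitivity (conjc q * q *
    (conjc (T m i) * T m j) * (conjc (cexpi (thphi m)) * cexpi (thphi m))).
    by rewrite cexpi_conj_mul mulr1.
  by ring.
rewrite (bigD1 j) //= eqxx mulr1 big1 ?addr0 => [|l /negPf ->]; last by rewrite !mulr0.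
rewrite eq_sym; case: eqP => _; first by rewrite mulr1 csqrt_conj_mul.
by rewrite mulr0 rmorph0 mul0r.
Qed.

(** Dividing by [bd * NH > 0] leaves the identity plus a nonnegative multiple of a Gram matrix,
    whose determinant is at least 1. *)
Lemma psub_Psimat_unit (Q : {set 'I_Nt}) : 0 < bd * NH ->
  psub Q (Psimat bt br bd NR NH T) \in unitmx.
Proof.
move=> b0; have a0 : 0 <= bt * br * NR by rewrite !mulr_ge0.
set b := bd * NH in b0 *; set a := bt * br * NR in a0 *.
have -> : psub Q (Psimat bt br bd NR NH T) =
    b%:C *: (1%:M + (a / b)%:C *: (ctr (colpick Q T) *m colpick Q T)).
  rewrite scalerDr scalerA -rmorphM mulrCA divff ?gt_eqF // mulr1 -psub_gram.
  apply/matrixP => i j; rewrite !mxE -/a -/b (inj_eq enum_val_inj) addrC.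
  by congr (_ + _); rewrite -mulr_natr.
rewrite unitmxE detZ unitfE mulf_neq0 //.
  by rewrite expf_neq0 // eq_complex /= gt_eqF.
rewrite gt_eqF //; apply: (lt_le_trans ltr01); apply: det_1Dgram_ge1.
by rewrite divr_ge0 // ltW.
Qed.

End ChannelMatrices.

(** * The bound on the ergodic capacity *)

Theorem theorem1
  (R : realType) (Nt Nr Mh Mv PT PR PH : nat)
  (dt dr dh dv lam : R)
  (tg : 'I_PT -> R[i]) (phia1 tha1 thd1 : 'I_PT -> R)
  (rg : 'I_PR -> R[i]) (tha2 phid2 thd2 : 'I_PR -> R)
  (hg : 'I_PH -> R[i]) (tha3 thd3 : 'I_PH -> R)
  (thphi : 'I_(Mh * Mv) -> R)
  (bt br bd LR NR LH NH rho : R)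
  (d : measure_display) (Omega : measurableType d) (P : probability Omega R)
  (Rt : Omega -> 'M[R[i]]_(Nr, Mh * Mv)) (Ht : Omega -> 'M[R[i]]_(Nr, Nt))
  (theta : {set 'I_Nt} -> seq R) :
  (0 < Nt)%N -> (0 < Nr)%N -> (0 < Mh)%N -> (0 < Mv)%N ->
  (0 < PT)%N -> (0 < PR)%N -> (0 < PH)%N ->
  (Nt <= Nr)%N ->
  0 < dt -> 0 < dr -> 0 < dh -> 0 < dv -> 0 < lam ->
  0 < bt -> 0 < br -> 0 < bd ->
  0 <= LR -> 0 <= NR -> LR + NR = 1 ->
  0 <= LH -> 0 < NH -> LH + NH = 1 ->
  0 < rho ->
  iid_CN01 P Rt Ht ->
  let T := Tlos Nt Mh Mv (dt / lam) (dh / lam) (dv / lam) tg phia1 tha1 thd1 in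
  let Rb := Rlos Nr Mh Mv (dr / lam) (dh / lam) (dv / lam) rg tha2 phid2 thd2 in
  let Hb := Hlos Nr Nt (dr / lam) (dt / lam) hg tha3 thd3 in
  let Ph := Phimat thphi in
  let G := fun w => Gchan bt br bd LR NR LH NH Rb Ph T Hb (Rt w) (Ht w) in
  let rhob := rho / Nt%:R in
  let Gb := Gbar bt br bd LR LH Rb Ph T Hb in
  let Sigma := ctr Gb *m Gb in
  let Psi := Psimat bt br bd NR NH T in
  (forall Q : {set 'I_Nt},
     nonzero_eigs (invmx (psub Q Psi) *m psub Q Sigma) (theta Q)) ->
  (\int[P]_w
     (log2 (complex.Re (\det (1%:M + rhob%:C *: (G w *m ctr (G w))))))%:E
   <= (log2 (complex.Re (ris_bound Nr rhob Psi Sigma theta)))%:E)%E.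
Proof.
move=> Nt0 Nr0 Mh0 Mv0 PT0 PR0 PH0 NtNr dt0 dr0 dh0 dv0 lam0 bt0 br0 bd0.
move=> LR0 NR0 LRNR LH0 NH0 LHNH rho0 iid.
move=> T Rb Hb Ph G rhob Gb Sigma Psi eigs.
have rhob0 : 0 <= rhob by rewrite divr_ge0 // ltW.
have [mX lawX indX] := iid.
have momX := entries_moments iid.
pose c := noise_coef bt br bd NR NH thphi T.
have GE w k j : G w k j = Gb k j + \sum_u c u j * entry Rt Ht k u w.
  by apply: GchanE; exact: ltW.
have cov k i j : Ec P (fun w => conjc (G w k i) * G w k j) =
    conjc (Gb k i) * Gb k j + Psi i j.
  by rewrite (channel_covariance iid GE) (PsimatE thphi T) //; exact: ltW.
(* For each [Q], the selected columns of [G] keep independent rows and have noise covariance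
   [psub Q Psi], so the mean Gram determinant applies. *)
have HQ (Q : {set 'I_Nt}) :
    csummable P (fun w => \det (psub Q (ctr (G w) *m G w))) /\
    Ec P (fun w => \det (psub Q (ctr (G w) *m G w))) =
    \det (psub Q Psi) * (Jfun Nr (theta Q))%:C *
      (((Nr - size (theta Q))`!)%:R / ((Nr - #|Q|)`!)%:R).
  under eq_fun do rewrite psub_gram.
  have pQ k j : polyon (entries_family Rt Ht) (fun i => row_of i == k)
      (fun w => colpick Q (G w) k j).
    have -> : (fun w => colpick Q (G w) k j) = fun w => G w k (enum_val j).
      by apply/funext => w; rewrite colpickE.
    exact: polyon_channel GE k _.
  have cQ k i j : Ec P (fun w => conjc (colpick Q (G w) k i) * colpick Q (G w) k j) =
      conjc (colpick Q Gb k i) * colpick Q Gb k j + psub Q Psi i j.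
    rewrite !colpickE psubE -cov; congr (Ec P _).
    by apply/funext => w; rewrite !colpickE.
  have [S E] := expectation_det_gram mX indX momX Nr0 pQ cQ.
  split => //; rewrite E -psub_gram; apply: sum_mixmx_Jfun => //.
    by apply: leq_trans NtNr; rewrite (leq_trans (max_card _)) ?card_ord.
  by apply: psub_Psimat_unit; rewrite ?mulr_gt0 // ltW.
(* Sylvester's identity passes to size [Nt], where the determinant expands into principal minors. *)
have detE w : \det (1%:M + rhob%:C *: (G w *m ctr (G w))) =
    \sum_(Q : {set 'I_Nt}) rhob%:C ^+ #|Q| * \det (psub Q (ctr (G w) *m G w)).
  by rewrite scalemxAl det_1D_mulmxC -scalemxAr det_1Dgram.
pose D w := \det (1%:M + rhob%:C *: (G w *m ctr (G w))).
have SQ (Q : {set 'I_Nt}) :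
    csummable P (fun w => rhob%:C ^+ #|Q| * \det (psub Q (ctr (G w) *m G w))).
  by apply: csummableZ; exact: (HQ Q).1.
have DE : D = fun w =>
    \sum_(Q : {set 'I_Nt}) rhob%:C ^+ #|Q| * \det (psub Q (ctr (G w) *m G w)).
  by apply/funext => w; exact: detE.
have SD : csummable P D by rewrite DE; apply: csummable_sum.
have ED : Ec P D = ris_bound Nr rhob Psi Sigma theta.
  rewrite DE Ec_sum // /ris_bound.
  under [RHS]eq_bigr do rewrite big_distrr.
  (* The bound groups the sets [Q] by cardinality; after exchanging the sums only [t = #|Q|] remains
     for each [Q]. *)
  rewrite [RHS](exchange_big_dep xpredT) //=; apply: eq_bigr => Q _.
  have cQ : (#|Q| < Nt.+1)%N by rewrite ltnS (leq_trans (max_card _)) ?card_ord.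
  rewrite (big_pred1 (Ordinal cQ)) => [|t]; last by rewrite /= -val_eqE eq_sym.
  by rewrite EcZ ?(HQ Q).2 //; exact: (HQ Q).1.
have D1 w : 1 <= complex.Re (D w).
  have := det_1Dgram_ge1 (G w) rhob0; rewrite det_1Dgram -detE -/(D w).
  by rewrite lecE /= => /andP[].
have := integral_log2_le D1 SD.1.
have -> : Ex P (fun w => complex.Re (D w)) = complex.Re (Ec P D) by [].
by rewrite ED.
Qed.
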